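(* Let $\tilde F_k$ be the stable cluster variables of the framed conifold quiver with mutation sequence $(0,1,0,1,\ldots)$, and let $$T=\sum_{P\text{ a simple partition of }AD_\infty} y_0^{\,x(P)+h(P)+\#\text{altered rows of }P}\;y_1^{\,x(P)+h(P)}$$ be the partition function of simple partitions of the infinite 2-color Aztec diamond pyramid $AD_\infty$ (all as defined in the context). Then $$\lim_{k\to\infty}\tilde F_k = T,$$ the limit being taken as formal power series in $y_0,y_1$.
   Context: Framed conifold quiver $Q_0$: vertices $0,1$ and frozen vertices $0',1'$ (never mutated); arrows: two arrows $0\to 1$, two arrows $1\to 0$, one arrow $0\to 0'$, one arrow $1\to 1'$. Initial labels: $1$ at $0$ and $1$, $y_0$ at $0'$, $y_1$ at $1'$. Mutation at $v\in\{0,1\}$: (1) replace the label $\ell_v$ by $\bigl(\prod_{\text{arrows } u\to v}\ell_u+\prod_{\text{arrows } v\to u}\ell_u\bigr)/\ell_v$ (products over arrows with multiplicity, using the arrows before mutation); (2) for every 2-path $u\to v\to w$ add an arrow $u\to w$; (3) remove all self-loops created, and cancel in pairs the 2-cycles created between a non-frozen and a frozen vertex (the 2-cycles between $0$ and $1$ are kept); (4) reverse all arrows incident to $v$. Mutate successively at $0,1,0,1,\ldots$; $Q_k$ is the quiver after $k$ mutations and $F_k$ is the new label produced at the $k$-th mutation. $C_k$ is the $2\times2$ matrix whose $(i,j)$ entry is the number of arrows $i'\to j$ in $Q_k$ (negative if the arrows point $j\to i'$). $\tilde F_k$ is obtained from $F_k$ by replacing each monomial $y_0^{a_0}y_1^{a_1}$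 by $y_0^{b_0}y_1^{b_1}$ with $\vec b=C_k^{-1}\vec a$. Convention on parity: for odd $k$, $C_k^{-1}=\begin{bmatrix}k&-(k+1)\\k-1&-k\end{bmatrix}$, and for even $k$ it is the same expression with rows interchanged; to remove the alternation between $y_0$ and $y_1$ the odd form is used for all $k$, i.e. for all $k\ge1$ each monomial $y_0^{a}y_1^{b}$ of $F_k$ is replaced by $y_0^{ka-(k+1)b}y_1^{(k-1)a-kb}$. Infinite Aztec diamond pyramid $AD_\infty$: it consists of layers $j=1,2,3,\ldots$ (from the top), layer $j$ consisting of $j$ rows $(j,r)$, $1\le r\le j$. Each row $(j,r)$ is an infinite row pyramid: it has a left part with white stones $w_{j,r,c}$ and black stones $b_{j,r,c}$ ($c\ge1$, counted from the left end inward), and a right part with white stones $w'_{j,r,c}$ and black stones $b'_{j,r,c}$ ($c\ge 1$, counted from the right end inward). Within a row, $b_{j,r,c}$ lies beneath $w_{j,r,c}$ and $w_{j,r,c+1}$, and $b'_{j,r,c}$ lies beneath $w'_{j,r,c}$ and $w'_{j,r,c+1}$. Between layers, $w_{j+1,r,c}$ lies beneath those of $b_{j,r-1,c}$, $b_{j,r,c}$ that exist (i.e. whose row index is in $\{1,\dots,j\}$), and likewise $w'_{j+1,r,c}$ lies beneath those of $b'_{j,r-1,c}$, $b'_{j,r,c}$ that exist. The left-to-right order of the white stones in a row is $w_{j,r,1},w_{j,r,2},\ldots,\ldots,w'_{j,r,2},w'_{j,r,1}$. A partition of $AD_\infty$ is a configuration obtained by removing stones such that (stability) whenever a stone is removed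 every stone lying on top of it is removed, and such that in each row either no stones are removed, or an infinite number of stones are removed such that only a finite number of stones of the row remains. A row is altered if at least one of its stones is removed. A partition is simple if its restriction to each row is simple: either no stones of the row are removed, or the removed white stones of the row form one consecutive (infinite) block and no exposed black stone remains in the row (a black stone is exposed if all white stones of its row lying on top of it have been removed). The partition removing no stones is simple. The height of a row is its distance from the top layer, the top row having height $0$: $h((j,r))=j-1$. For a simple partition $P$, $h(P)=\sum_{r\text{ altered row of }P}h(r)$ and $x(P)=\sum_{r\text{ altered row of }P}(\#\text{ non-removed white stones in }r)$ (equivalently, the same sum with black stones). *)

(* Defs.v *)
From HB Require Import structures.
From mathcomp Require Import all_boot all_order all_algebra.
From mathcomp Require Import mpoly.
From mathcomp Require Import mathcomp_extra boolp classical_sets functions.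
From mathcomp Require Import cardinality finmap fingroup perm zify.

Set Implicit Arguments.
Unset Strict Implicit.
Unset Printing Implicit Defensive.

Import Order.TTheory GRing.Theory Num.Theory.

(* [inl i] is the mutable vertex i and [inr i] the frozen vertex i'. *)
Definition vertex : finType := ('I_2 + 'I_2)%type.

Definition v0 : 'I_2 := ord0.
Definition v1 : 'I_2 := ord_max.

(* [Q u v] is the number of arrows u -> v. *)
Definition quiver := vertex -> vertex -> nat.

Definition conifold : quiver := fun u v =>
  match u, v with
  | inl i, inl j => if i == j then 0 else 2
  | inl i, inr j => if i == j then 1 else 0
  | inr _, _ => 0
  end.

Definition is_frozen (u : vertex) : bool := if u is inr _ then true else false.

Definition add_paths (Q : quiver) (v : vertex) : quiver := fun u w =>
  Q u w + Q u v * Q v w.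

Definition remove_loops (Q : quiver) : quiver := fun u w =>
  if u == w then 0 else Q u w.

(* The subtraction is truncated: of the arrows u -> w and w -> u, min of the
   two numbers is cancelled on both sides. *)
Definition cancel_2cycles (Q : quiver) : quiver := fun u w =>
  if is_frozen u != is_frozen w then Q u w - Q w u else Q u w.

Definition reverse_at (Q : quiver) (v : vertex) : quiver := fun u w =>
  if (u == v) || (w == v) then Q w u else Q u w.

Definition mutate_quiver (Q : quiver) (v : vertex) : quiver :=
  reverse_at (cancel_2cycles (remove_loops (add_paths Q v))) v.

Definition label := {fraction {mpoly int[2]}}.

Definition mutate_labels (Q : quiver) (l : vertex -> label) (v : vertex) :
    vertex -> label := fun u =>
  if u == v then
    ((\prod_(w : vertex) l w ^+ Q w v + \prod_(w : vertex) l w ^+ Q v w)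
       / l v)%R
  else l u.

Definition initial_labels (u : vertex) : label :=
  match u with
  | inl _ => 1%R
  | inr i => tofrac ('X_i : {mpoly int[2]})%R
  end.

(* The vertex of the k-th mutation, k >= 1: the sequence is 0, 1, 0, 1, ... *)
Definition mutated_vertex (k : nat) : vertex := inl (if odd k then v0 else v1).

Fixpoint seed (k : nat) : quiver * (vertex -> label) :=
  if k is k'.+1 then
    (mutate_quiver (seed k').1 (mutated_vertex k),
     mutate_labels (seed k').1 (seed k').2 (mutated_vertex k))
  else (conifold, initial_labels).

Definition cluster_variable (k : nat) : label :=
  (seed k).2 (mutated_vertex k).

Definition Fpoly (k : nat) : {mpoly int[2]} :=
  xget 0%R [set p | tofrac p = cluster_variable k]%classic.

Definition quiver_after (n : nat) : quiver := fun u v =>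
  match u, v with
  | inl i, inl j => if i == j then 0 else 2
  | inr i, inl j =>
      if odd n then if j == v1 then (if i == v0 then n.+1 else n) else 0
      else if j == v0 then (if i == v0 then n.+1 else n) else 0
  | inl j, inr i =>
      if odd n then if j == v0 then (if i == v0 then n.+2 else n.+1) else 0
      else if j == v1 then (if i == v0 then n.+2 else n.+1) else 0
  | inr _, inr _ => 0
  end.

Lemma ord2P (i : 'I_2) : i = v0 \/ i = v1.
Proof. by case: i => [[|[|//]] H]; [left|right]; apply/val_inj. Qed.

Lemma seedQ n : (seed n.+1).1 = quiver_after n.
Proof.
elim: n => [|n IH].
  apply/funext => u; apply/funext => v /=.
  case: u => i; case: v => j; case: (ord2P i) => ->; case: (ord2P j) => -> //=.
have -> : (seed n.+2).1 = mutate_quiver (seed n.+1).1 (mutated_vertex n.+2).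
  by [].
rewrite {}IH /mutated_vertex /= negbK.
apply/funext => u; apply/funext => v.
rewrite /mutate_quiver /reverse_at /cancel_2cycles /remove_loops /add_paths.
rewrite /quiver_after /=.
case: (odd n) => /=; case: u => i; case: v => j;
  case: (ord2P i) => ->; case: (ord2P j) => -> //=; lia.
Qed.

Section Stable.
Local Open Scope ring_scope.

Definition Cmx (k : nat) : 'M[int]_2 := \matrix_(i, j)
  (((seed k).1 (inr i) (inl j))%:Z - ((seed k).1 (inl j) (inr i))%:Z).

(* [C_k^-1], with its rows interchanged for even [k] so as to undo the
   alternation between [y_0] and [y_1]; see [stable_mxE] for the entries. *)
Definition stable_mx (k : nat) : 'M[int]_2 :=
  if odd k then invmx (Cmx k) else xrow v0 v1 (invmx (Cmx k)).

Lemma matrix2P (A B : 'M[int]_2) :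
  A v0 v0 = B v0 v0 -> A v0 v1 = B v0 v1 ->
  A v1 v0 = B v1 v0 -> A v1 v1 = B v1 v1 -> A = B.
Proof.
move=> h1 h2 h3 h4; apply/matrixP => i j.
by case: (ord2P i) => ->; case: (ord2P j) => ->.
Qed.

Definition stable_entries (k : nat) : 'M[int]_2 := \matrix_(i, j)
  (if i == v0 then if j == v0 then k%:Z else - k.+1%:Z
   else if j == v0 then k%:Z - 1 else - k%:Z).

Lemma stable_mxE k : (0 < k)%N -> stable_mx k = stable_entries k.
Proof.
case: k => // n _; rewrite /stable_mx.
have E (C D : 'M[int]_2) : D *m C = 1%:M -> invmx C = D.
  move=> DC; have [_ Cu] := mulmx1_unit DC.
  by rewrite -[D](mulmxK Cu) DC mul1mx.
case: ifP => /= odd_n; last first.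
  rewrite (E _ (xrow v0 v1 (stable_entries n.+1))).
    by apply/matrixP => i j; rewrite !mxE tpermK.
  apply: matrix2P;
    rewrite !mxE big_ord_recl big_ord1 !mxE seedQ /quiver_after /=
      (negbFE odd_n) /= -/v0 -/v1 ?tpermL ?tpermR /=; lia.
by apply: E; apply: matrix2P;
  rewrite !mxE big_ord_recl big_ord1 !mxE seedQ /quiver_after /=
    (negbTE odd_n) /=; lia.
Qed.

(* A Laurent polynomial or Laurent series in [y_0, y_1], given by the
   coefficient of each monomial [y^b], [b] in [Z^2]. *)
Definition laurent := 'cV[int]_2 -> int.

Definition expo (m : 'X_{1..2}) : 'cV[int]_2 := \col_i (m i)%:Z.

Definition Fstable (k : nat) : laurent := fun b =>
  \sum_(m <- msupp (Fpoly k) | stable_mx k *m expo m == b) (Fpoly k)@_m.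

Definition is_power_series (f : laurent) : Prop :=
  forall b : 'cV[int]_2, (exists i, b i 0 < 0) -> f b = 0.

(* Convergence of formal power series: each coefficient is eventually equal to
   that of the limit. *)
Definition ps_limit (f : nat -> laurent) (g : laurent) : Prop :=
  forall b : 'cV[int]_2, exists K : nat, forall k, (K <= k)%N -> f k b = g b.

End Stable.

Inductive color := White | Black.
Inductive side := Left | Right.

(* [Stone White Left j r c], [Stone Black Left j r c],
   [Stone White Right j r c], [Stone Black Right j r c] are respectively
   [w_{j,r,c}], [b_{j,r,c}], [w'_{j,r,c}] and [b'_{j,r,c}]. All indices start
   at 1: the stones of the pyramid are the elements of [AD_infty]. *)
Record stone := Stone {
  scolor : color;
  sside : side;
  slayer : nat;
  srow : nat;
  spos : nat }.

HB.instance Definition _ := gen_eqMixin stone.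
HB.instance Definition _ := gen_choiceMixin stone.

Local Open Scope classical_set_scope.

Definition AD_rows : set (nat * nat) := [set jr | 1 <= jr.2 <= jr.1].

Definition AD_infty : set stone :=
  [set s | AD_rows (slayer s, srow s) /\ 1 <= spos s].

Definition row_stones (jr : nat * nat) : set stone :=
  [set s | AD_infty s /\ (slayer s, srow s) = jr].

(* [on_top s t]: the stone [t] lies (immediately) beneath [s], provided that
   both belong to the pyramid. *)
Inductive on_top : stone -> stone -> Prop :=
| on_top_outer d j r c : on_top (Stone White d j r c) (Stone Black d j r c)
| on_top_inner d j r c : on_top (Stone White d j r c.+1) (Stone Black d j r c)
| on_top_prev d j r c :
    on_top (Stone Black d j r c) (Stone White d j.+1 r.+1 c)
| on_top_same d j r c :
    on_top (Stone Black d j r c) (Stone White d j.+1 r c).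

(* Left-to-right order of the positions of the white stones of a row. *)
Definition left_of (s t : stone) : Prop :=
  match sside s, sside t with
  | Left, Left => spos s < spos t
  | Left, Right => True
  | Right, Left => False
  | Right, Right => spos t < spos s
  end.

(* A configuration is represented by the set [P] of its removed stones. *)
Definition altered (P : set stone) : set (nat * nat) :=
  [set jr | AD_rows jr /\ P `&` row_stones jr !=set0].

Definition stable (P : set stone) : Prop :=
  forall s t, AD_infty s -> AD_infty t -> on_top s t -> P t -> P s.

Definition is_partition (P : set stone) : Prop :=
  [/\ P `<=` AD_infty,
      stable P
    & forall jr, altered P jr ->
        infinite_set (row_stones jr `&` P) /\
        finite_set (row_stones jr `\` P)].

Definition white_stones (jr : nat * nat) : set stone :=
  [set s | row_stones jr s /\ scolor s = White].

Definition black_stones (jr : nat * nat) : set stone :=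
  [set s | row_stones jr s /\ scolor s = Black].

Definition consecutive (jr : nat * nat) (A : set stone) : Prop :=
  forall s t u, A s -> white_stones jr t -> A u ->
    left_of s t -> left_of t u -> A t.

Definition exposed (P : set stone) (jr : nat * nat) (t : stone) : Prop :=
  black_stones jr t /\
  forall s, white_stones jr s -> on_top s t -> P s.

Definition simple_row (P : set stone) (jr : nat * nat) : Prop :=
  altered P jr ->
  [/\ infinite_set (white_stones jr `&` P),
      consecutive jr (white_stones jr `&` P)
    & forall t, exposed P jr t -> P t].

Definition is_simple_partition (P : set stone) : Prop :=
  is_partition P /\ forall jr, AD_rows jr -> simple_row P jr.

Definition height (jr : nat * nat) : nat := jr.1 - 1.

(* The next three statistics are meaningful when only finitely many rows of
   [P] are altered. *)
Definition n_altered (P : set stone) : nat := #|` fset_set (altered P)|.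

Definition hP (P : set stone) : nat :=
  \sum_(jr <- fset_set (altered P)) height jr.

Definition xP (P : set stone) : nat :=
  \sum_(jr <- fset_set (altered P)) #|` fset_set (white_stones jr `\` P)|.

(* The simple partitions whose monomial in the partition function is
   [y_0^a y_1^b]. A simple partition altering infinitely many rows has infinite
   height, so it contributes to no monomial. *)
Definition simple_partitions_of_weight (a b : nat) : set (set stone) :=
  [set P | [/\ is_simple_partition P,
               finite_set (altered P),
               xP P + hP P + n_altered P = a
             & xP P + hP P = b]].

Definition Tcoef (a b : nat) : nat :=
  #|` fset_set (simple_partitions_of_weight a b)|.

Definition Tseries : laurent := fun b =>
  match b v0 ord0, b v1 ord0 with
  | Posz a0, Posz a1 => Posz (Tcoef a0 a1)
  | _, _ => 0%R
  end.

(* Main.v *)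
Require Import Defs.
From mathcomp Require Import all_boot all_order all_algebra.
From mathcomp Require Import mpoly zify ring.

Set Implicit Arguments.
Unset Strict Implicit.
Unset Printing Implicit Defensive.

Import GRing.Theory.

(** The cluster variables satisfy [F_(k+2) F_k = F_(k+1)^2 (1 + y_0^(k+2) y_1^(k+1))],
whence [F_k] is the product of [1 + y_0^(j+1) y_1^j] over [j <= i < k].  Put
[q = y_0 y_1].  The change of exponents maps [(j+1, j)] to [(k-j, k-1-j)], so the
stable variables are the products of [1 + y_0 q^(u+v)] over [u + v < k], and their
limit is the product over all [u, v >= 0].

Index the row [(j, r)] by the cell [(a, b) = (r-1, j-r)].  The altered rows of a
simple partition form a Young diagram.  If [m] and [n] white stones remain on the
left and on the right of the row [(a, b)], stability says that [m + a] and the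
transpose of [n + b] fill this diagram as semistandard tableaux.  The weight of
the partition is the product over the cells of [y_0 q^((m+a)+(n+b))], so [T] is
the sum over shapes of [s_la(x) s_la'(y)] with [x_i = y_0 q^i] and [y_j = q^j],
which the dual Cauchy identity evaluates as the product of [1 + x_i y_j].

The dual Cauchy identity follows, by adding one variable at a time, from the
commutation of adding a horizontal strip with adding a vertical strip, in which
the sums over intermediate shapes factor over the rows. *)

(** * The dual Cauchy identity for sums over chains of strips *)

Section Cauchy.
Variables (R : comNzRingType) (K : nat).
Local Open Scope ring_scope.

(** Row lengths in a box of [K] rows and [K] columns. The type is finite and its rows are
    independent, so sums over shapes can factor over the rows. *)
Definition row_shape := {ffun 'I_K -> 'I_K.+1}.

Implicit Types k l m n : row_shape.

Definition rowlen l (i : nat) : nat := oapp (fun j => l j : nat) 0%N (insub i).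

(** The bound that a horizontal strip added to [l] puts on row [i]: the previous row of [l], or the
    box width [K] for the first row. *)
Definition prev l (i : nat) : nat := if i is j.+1 then rowlen l j else K.

Definition partition_shape l := [forall i : 'I_K, rowlen l i.+1 <= rowlen l i]%N.

(** These interlacing inequalities already make both shapes partitions, whereas a vertical strip has
    to demand it. *)
Definition hstrip k l :=
  [forall i : 'I_K, (rowlen k i <= rowlen l i) && (rowlen l i.+1 <= rowlen k i)]%N.

Definition vstrip k l :=
  [&& partition_shape k, partition_shape l
    & [forall i : 'I_K, rowlen k i <= rowlen l i <= (rowlen k i).+1]]%N.

Definition strip_size k l := (\sum_(i < K) (rowlen l i - rowlen k i))%N.

(** By the branching rule, for a partition [l] this is the Schur polynomial of [l] in [t] variables
    if [S] is [hstrip], and that of the transpose of [l] if [S] is [vstrip]. *)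
Fixpoint tableau_sum (S : rel row_shape) (x : nat -> R) (t : nat) (l : row_shape) : R :=
  if t is t'.+1 then
    \sum_(k | S k l) x t' ^+ strip_size k l * tableau_sum S x t' k
  else (l == [ffun=> ord0])%:R.

Lemma rowlenE l (i : 'I_K) : rowlen l i = l i.
Proof. by rewrite /rowlen valK. Qed.

Lemma rowlen_out l i : (K <= i)%N -> rowlen l i = 0%N.
Proof. by move=> Ki; rewrite /rowlen insubN // -leqNgt. Qed.

Lemma rowlen_le l i : (rowlen l i <= K)%N.
Proof. by rewrite /rowlen; case: insub => //= j; rewrite -ltnS. Qed.

Lemma rowlen0 i : rowlen [ffun=> ord0] i = 0%N.
Proof. by rewrite /rowlen; case: insub => //= j; rewrite ffunE. Qed.

Lemma shapeP l m : (forall i, rowlen l i = rowlen m i) -> l = m.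
Proof. by move=> e; apply/ffunP => i; apply: val_inj; rewrite /= -!rowlenE. Qed.

Lemma partition_shapeP l :
  reflect (forall i, rowlen l i.+1 <= rowlen l i)%N (partition_shape l).
Proof.
apply: (iffP forallP) => h i //; have [iK|Ki] := ltnP i K.
  exact: (h (Ordinal iK)).
by rewrite !rowlen_out // ltnW.
Qed.

Lemma hstripP k l :
  reflect (forall i, rowlen k i <= rowlen l i /\ rowlen l i.+1 <= rowlen k i)%N (hstrip k l).
Proof.
apply: (iffP forallP) => h i; last by apply/andP.
have [iK|Ki] := ltnP i K; first exact/andP/(h (Ordinal iK)).
by rewrite !rowlen_out // ltnW.
Qed.

Lemma hstrip_partition k l : hstrip k l -> partition_shape k && partition_shape l.
Proof.
move=> /hstripP h; apply/andP; split; apply/partition_shapeP => i.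
  by apply: leq_trans (proj2 (h i)); apply: (proj1 (h _)).
by apply: leq_trans (proj1 (h i)); apply: (proj2 (h _)).
Qed.

Lemma vstripP k l :
  reflect [/\ partition_shape k, partition_shape l
    & forall i, rowlen k i <= rowlen l i <= (rowlen k i).+1]%N (vstrip k l).
Proof.
apply: (iffP and3P) => -[pk pl h]; split=> //; last by apply/forallP => i.
move=> i; have [iK|Ki] := ltnP i K; first by move/forallP: h => /(_ (Ordinal iK)).
by rewrite !rowlen_out.
Qed.

(** In a vertical strip a row keeps its length or grows by one, so a sum over the larger length has
    two terms; [l < K] leaves room for the second. *)
Lemma sum_succ_pair (P : pred nat) (F : nat -> R) (l : nat) : (l < K)%N ->
  \sum_(v < K.+1 | P v && (l <= v <= l.+1)%N) F v =
  (if P l then F l else 0) + (if P l.+1 then F l.+1 else 0).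
Proof.
move=> lK; rewrite big_mkcond /= (bigD1 (inord l)) //=.
rewrite (bigD1 (inord l.+1)) /=; last first.
  by rewrite -val_eqE /= !inordK //; lia.
rewrite big1 => [|v]; last first.
  rewrite -!val_eqE /= !inordK; try lia.
  by move=> /andP[]; case: (P v) => //=; case: ifP => //; lia.
by rewrite !inordK; try lia; rewrite addr0 !leqnn !leqnSn !andbT.
Qed.

Lemma sum_pred_pair (P : pred nat) (F : nat -> R) (m : nat) : (m <= K)%N ->
  \sum_(v < K.+1 | P v && (v <= m <= v.+1)%N) F v =
  (if P m then F m else 0) + (if (0 < m)%N && P m.-1 then F m.-1 else 0).
Proof.
move=> mK; case: m mK => [|m] mK /=.
  rewrite big_mkcond /= (bigD1 ord0) //= big1 => [|v].
    by rewrite !andbT.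
  by rewrite -val_eqE /=; case: (P v) => //=; case: ifP => //; lia.
rewrite addrC -sum_succ_pair //; apply: eq_bigl => v.
by congr (_ && _); lia.
Qed.

Section LocalRule.
Variables x y : R.

(* The sums over the [i]-th part of the larger and of the smaller shape agree
   only up to the factors [corner (l i) (m (i-1))] and [corner (l (i+1)) (m i)],
   which telescope over [i]. *)
Definition corner (l p : nat) : R :=
  if (l < p)%N then 1 + x * y else if (l == p)%N then 1 else 0.

(* [l], [l'], [m], [p] stand for [l i], [l (i+1)], [m i], [m (i-1)]. *)
Lemma local_rule_row (l l' m p : nat) : (l' <= l)%N -> (m <= p)%N ->
  ((if (m <= l <= p)%N then x ^+ (l - m) * y ^+ (l - l) else 0) +
   (if (m <= l.+1 <= p)%N then x ^+ (l.+1 - m) * y ^+ (l.+1 - l) else 0))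
     * corner l' m =
  ((if (l' <= m <= l)%N then x ^+ (l - m) * y ^+ (m - m) else 0) +
   (if (0 < m)%N && (l' <= m.-1 <= l)%N
    then x ^+ (l - m.-1) * y ^+ (m - m.-1) else 0)) * corner l p.
Proof.
move=> l'l mp; rewrite /corner !subnn subSnn !expr0 !expr1 !mulr1.
have [ml|lm] := leqP m l.
  have -> : (m <= l.+1 <= p)%N = (l < p)%N by lia.
  have -> : (0 < m)%N && (l' <= m.-1 <= l)%N = (l' < m)%N by lia.
  rewrite /= andbT subSn // [(l <= p)%N]leq_eqVlt [(l' <= m)%N]leq_eqVlt.
  have eB : (l' < m)%N -> x ^+ (l - m.-1) * y ^+ (m - m.-1) = x * x ^+ (l - m) * y.
    move=> lm'; have -> : (m - m.-1 = 1)%N by lia.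
    by rewrite -exprS; congr (x ^+ _ * _); lia.
  by have [/eB->||] := ltngtP l' m; have [||] := ltngtP l p; rewrite ?exprS /= => *; ring.
rewrite !andbF /= !add0r.
(* With [l < m] both sums are empty unless [m = l + 1], when one term survives on each side. *)
have /orP[ml|/eqP em] : (l.+1 < m)%N || (m == l.+1) by lia.
  have -> : (m <= l.+1 <= p)%N = false by lia.
  have -> : (0 < m)%N && (l' <= m.-1 <= l)%N = false by lia.
  by rewrite !mul0r.
subst m; rewrite /= !leqnn mp ltnS l'l /= subnn subSnn expr0 expr1.
by rewrite subnn expr0.
Qed.

(** Both sums factor over the rows, and the row identities telescope. In operator terms, adding a
    horizontal strip commutes with removing a vertical strip up to the factor [1 + x * y]. *)
Lemma local_rule l m :
  partition_shape l -> partition_shape m -> (forall i, rowlen l i < K)%N ->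
  rowlen m K.-1 = 0%N -> (0 < K)%N ->
  \sum_(n | hstrip m n && vstrip l n) x ^+ strip_size m n * y ^+ strip_size l n =
  (1 + x * y) *
  \sum_(k | hstrip k l && vstrip k m) x ^+ strip_size k l * y ^+ strip_size k m.
Proof.
move=> /[dup] pl /partition_shapeP pl' /[dup] pm /partition_shapeP pm' lK mK K0.
(* [A] and [B] are the conditions on the [i]-th part of [n] and of [k]. Each involves that part
   only, so the intermediate shapes range over a product of sets. *)
pose A (i v : nat) := ((rowlen m i <= v <= prev m i) && (rowlen l i <= v <= (rowlen l i).+1))%N.
pose B (i v : nat) := ((rowlen l i.+1 <= v <= rowlen l i) && (v <= rowlen m i <= v.+1))%N.
have prevm i : (rowlen m i <= prev m i)%N by case: i => [|i] /=; rewrite ?rowlen_le.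
have EA n : hstrip m n && vstrip l n = (n \in family (fun (i : 'I_K) (v : 'I_K.+1) => A i v)).
  apply/andP/familyP => [[/hstripP h /vstripP[_ _ v]] i|h].
    rewrite unfold_in /A -rowlenE (proj1 (h i)) v /= andbT.
    by case: (i : nat) => [|j] /=; [apply: rowlen_le | apply: (proj2 (h j))].
  have {}h i : A i (rowlen n i).
    have [iK|Ki] := ltnP i K; first by have := h (Ordinal iK); rewrite unfold_in -rowlenE.
    by rewrite /A (rowlen_out n) // (rowlen_out m) // (rowlen_out l).
  have hs : hstrip m n.
    apply/hstripP => i; split; first by have := h i; rewrite /A; lia.
    by have := h i.+1; rewrite /A /=; lia.
  split=> //; apply/vstripP; have /andP[_ pn] := hstrip_partition hs.
  by split=> // i; have := h i; rewrite /A; lia.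
have EB k : hstrip k l && vstrip k m = (k \in family (fun (i : 'I_K) (v : 'I_K.+1) => B i v)).
  apply/andP/familyP => [[/hstripP h /vstripP[_ _ v]] i|h].
    by rewrite unfold_in /B -rowlenE v (proj1 (h i)) (proj2 (h i)).
  have {}h i : B i (rowlen k i).
    have [iK|Ki] := ltnP i K; first by have := h (Ordinal iK); rewrite unfold_in -rowlenE.
    have := rowlen_out k Ki; have := rowlen_out m Ki; have := rowlen_out l Ki.
    by have := rowlen_out l (leqW Ki); rewrite /B; lia.
  have hs : hstrip k l.
    by apply/hstripP => i; have := h i; rewrite /B; lia.
  split=> //; apply/vstripP; have /andP[pk _] := hstrip_partition hs.
  by split=> // i; have := h i; rewrite /B; lia.
pose FA (i v : nat) := x ^+ (v - rowlen m i) * y ^+ (v - rowlen l i).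
pose FB (i v : nat) := x ^+ (rowlen l i - v) * y ^+ (rowlen m i - v).
pose SA i := \sum_(v < K.+1 | A i v) FA i v.
pose SB i := \sum_(v < K.+1 | B i v) FB i v.
have -> : \sum_(n | hstrip m n && vstrip l n)
    x ^+ strip_size m n * y ^+ strip_size l n = \prod_(i < K) SA i.
  rewrite (bigA_distr_big_dep (fun (i : 'I_K) (v : 'I_K.+1) => A i v)
    (fun i v => FA i v)) (eq_bigl _ _ EA); apply: eq_bigr => n _.
  by rewrite -!prodrXr -big_split /=; apply: eq_bigr => i _; rewrite /FA !rowlenE.
have -> : \sum_(k | hstrip k l && vstrip k m)
    x ^+ strip_size k l * y ^+ strip_size k m = \prod_(i < K) SB i.
  rewrite (bigA_distr_big_dep (fun (i : 'I_K) (v : 'I_K.+1) => B i v)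
    (fun i v => FB i v)) (eq_bigl _ _ EB); apply: eq_bigr => n _.
  by rewrite -!prodrXr -big_split /=; apply: eq_bigr => i _; rewrite /FB !rowlenE.
have step i : SA i * corner (rowlen l i.+1) (rowlen m i) = SB i * corner (rowlen l i) (prev m i).
  rewrite /SA /SB /A /B.
  rewrite (sum_succ_pair (fun v => (rowlen m i <= v <= prev m i)%N) (FA i)) //.
  rewrite (sum_pred_pair (fun v => (rowlen l i.+1 <= v <= rowlen l i)%N) (FB i)) ?rowlen_le //.
  exact: local_rule_row.
(* At [t = 0] the corner is [1 + x * y], since [prev m 0 = K] exceeds the first part of [l]; at
   [t = K] it is [corner 0 0 = 1]. *)
have part t : (\prod_(i < t) SA i) * corner (rowlen l t) (prev m t) =
    (1 + x * y) * \prod_(i < t) SB i.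
  elim: t => [|t IH]; first by rewrite !big_ord0 mul1r mulr1 /corner /= lK.
  rewrite !big_ord_recr /= -mulrA step mulrCA mulrC IH; ring.
have := part K; rewrite /corner rowlen_out //.
by case: K K0 mK => // K' _ /= ->; rewrite ltnn eqxx mulr1.
Qed.

End LocalRule.

(** Each vertical strip lengthens a row by at most one, so [t] of them build partitions with at most
    [t] columns. *)
Lemma tableau_sum_vstrip_eq0 (x : nat -> R) t l :
  ~~ (partition_shape l && [forall i : 'I_K, rowlen l i <= t]%N) ->
  tableau_sum vstrip x t l = 0.
Proof.
elim: t l => [|t IH] l nl /=.
  case: eqP => // e; move: nl; rewrite e; case/negP; apply/andP; split.
    by apply/partition_shapeP => i; rewrite !rowlen0.
  by apply/forallP => i; rewrite rowlen0.
apply: big1 => k /vstripP[pk pl h]; rewrite IH ?mulr0 //.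
apply: contra nl => /andP[_ /forallP kt]; rewrite pl; apply/forallP => i.
by have := kt i; have := h i; lia.
Qed.

(** Each horizontal strip creates at most one new row, so [t] of them reach at most [t] rows. *)
Lemma tableau_sum_hstrip_eq0 (x : nat -> R) t l i :
  (t <= i)%N -> rowlen l i != 0%N -> tableau_sum hstrip x t l = 0.
Proof.
elim: t l i => [|t IH] l i ti li /=.
  by case: eqP => // e; move: li; rewrite e rowlen0.
apply: big1 => k /hstripP h; case: i ti li => // i ti li.
by rewrite (IH k i) ?mulr0 //; have := proj2 (h i); lia.
Qed.

(** Induction on [N]: the last vertical strip is split off [n], [local_rule] moves it past the
    horizontal strip at the cost of [1 + x * y N], and the induction hypothesis applies to the
    smaller shape [k]. *)
Lemma pieri (x : R) (y : nat -> R) N m :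
  partition_shape m -> (N <= K)%N -> (0 < K)%N -> rowlen m K.-1 = 0%N ->
  \sum_(n | hstrip m n) x ^+ strip_size m n * tableau_sum vstrip y N n =
  (\prod_(j < N) (1 + x * y j)) * tableau_sum vstrip y N m.
Proof.
move=> pm + K0; elim: N m pm => [|N IH] m pm NK mK.
  rewrite big_ord0 mul1r /=; have [->|m0] := eqVneq m [ffun=> ord0].
    rewrite (bigD1 [ffun=> ord0]) /=; last first.
      by apply/hstripP => i; rewrite !rowlen0.
    rewrite eqxx mulr1 big1 ?addr0 => [|n /andP[_ /negPf->]]; last by rewrite mulr0.
    by rewrite /strip_size big1 // => i _; rewrite rowlen0.
  apply: big1 => n /hstripP h; case: eqP => [e|]; rewrite ?mulr0 //.
  case/eqP: m0; apply: shapeP => i; have := proj1 (h i).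
  by rewrite e !rowlen0 leqn0 => /eqP.
rewrite /= big_ord_recr /=.
under eq_bigr => n _ do rewrite big_distrr /=.
rewrite (exchange_big_dep predT) //=.
transitivity (\sum_l tableau_sum vstrip y N l *
   ((1 + x * y N) * \sum_(k | hstrip k l && vstrip k m)
      x ^+ strip_size k l * y N ^+ strip_size k m)).
  apply: eq_bigr => l _.
  (* Shapes other than partitions with at most [N] columns contribute nothing. In the others every
     row is at most [N < K], as [local_rule] requires. *)
  have [/andP[pl /forallP lN]|nl] :=
    boolP (partition_shape l && [forall i : 'I_K, rowlen l i <= N]%N); last first.
    rewrite (tableau_sum_vstrip_eq0 _ nl) mul0r big1 // => n _; ring.
  rewrite -local_rule //; last first.
    move=> i; have [iK|Ki] := ltnP i K; last by rewrite rowlen_out.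
    by have := lN (Ordinal iK) => /=; lia.
  by rewrite big_distrr; apply: eq_bigr => n _ /=; ring.
transitivity (\sum_l \sum_(k | hstrip k l && vstrip k m)
    (1 + x * y N) * y N ^+ strip_size k m *
      (x ^+ strip_size k l * tableau_sum vstrip y N l)).
  by apply: eq_bigr => l _; rewrite !big_distrr; apply: eq_bigr => k _ /=; ring.
rewrite (exchange_big_dep (fun k => vstrip k m)) /=; last by move=> l k _ /andP[].
rewrite big_distrr; apply: eq_bigr => k /[dup] km /vstripP[pk _ km'] /=.
transitivity ((1 + x * y N) * y N ^+ strip_size k m *
  \sum_(l | hstrip k l) x ^+ strip_size k l * tableau_sum vstrip y N l).
  rewrite big_distrr; apply: eq_big => [l|l _] /=; first by rewrite km andbT.
  by ring.
rewrite IH //; first by ring.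
- exact: ltnW.
- by have := km' K.-1; lia.
Qed.

(** Induction on the number of [x] variables: the last horizontal strip is split off [l], and
    [pieri] evaluates the sum over [l] for fixed [k]. *)
Lemma dual_cauchy (x y : nat -> R) M N : (M <= K)%N -> (N <= K)%N ->
  \sum_l tableau_sum hstrip x M l * tableau_sum vstrip y N l =
  \prod_(i < M) \prod_(j < N) (1 + x i * y j).
Proof.
move=> + NK; elim: M => [|M IH] MK.
  rewrite big_ord0 (bigD1 [ffun=> ord0]) //= eqxx mul1r.
  rewrite [X in _ + X]big1 ?addr0 => [|l /negPf->]; last by rewrite mul0r.
  elim: N {NK} => [|N IH] /=; first by rewrite eqxx.
  have v0 : vstrip [ffun=> ord0] [ffun=> ord0].
    have p0 : partition_shape [ffun=> ord0] by apply/partition_shapeP => i; rewrite !rowlen0.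
    by apply/vstripP; split=> // i; rewrite rowlen0.
  rewrite (bigD1 [ffun=> ord0]) //= IH mulr1 big1 ?addr0 => [|k /andP[]].
    by rewrite /strip_size big1 // => i _; rewrite rowlen0.
  move=> /vstripP[_ _ h] /eqP[]; apply: shapeP => i.
  by have := h i; rewrite rowlen0; lia.
rewrite big_ord_recr /= -(IH (ltnW MK)) big_distrl /=.
transitivity (\sum_l \sum_(k | hstrip k l) x M ^+ strip_size k l *
    tableau_sum hstrip x M k * tableau_sum vstrip y N l).
  by apply: eq_bigr => l _; rewrite big_distrl.
rewrite (exchange_big_dep predT) //=; apply: eq_bigr => k _.
transitivity (tableau_sum hstrip x M k *
  \sum_(l | hstrip k l) x M ^+ strip_size k l * tableau_sum vstrip y N l).
  by rewrite big_distrr; apply: eq_bigr => l _ /=; ring.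
have [/= pk|npk] := boolP (partition_shape k); last first.
  rewrite big1 ?mulr0 => [|l /hstrip_partition/andP[pk _]]; last by rewrite pk in npk.
  rewrite (@tableau_sum_vstrip_eq0 y N k); first by ring.
  by rewrite (negPf npk).
have K0 : (0 < K)%N by lia.
(* [pieri] asks for an empty last row of [k]. If that row is not empty, [M < K] variables cannot
   fill [k], and its sum vanishes. *)
have [k0|k0] := eqVneq (rowlen k K.-1) 0%N; first by rewrite pieri //; ring.
by rewrite (@tableau_sum_hstrip_eq0 x M k K.-1) ?mul0r //; lia.
Qed.

End Cauchy.

(** * Tableaux as fillings of a box *)

Section Tableaux.
Variables (R : comNzRingType) (K : nat).
Local Open Scope ring_scope.

Definition cell : finType := ('I_K * 'I_K)%type.
(* The value [K] marks the cells outside the tableau. *)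
Definition filling := {ffun cell -> 'I_K.+1}.

Implicit Types (k l : row_shape K) (f g : filling).

Definition diagram l : {set cell} := [set c : cell | c.2 < rowlen l c.1]%N.

Definition level f (t : nat) : {set cell} := [set c | f c < t]%N.

(** A tableau is read as the chain of shapes of its level sets, with [S] relating consecutive
    shapes; this treats both kinds of strip at once. *)
Definition is_tableau (S : rel (row_shape K)) (t : nat) l f :=
  [&& [forall c, (f c < t)%N || (f c == K :> nat)], level f K == diagram l
    & [forall s : 'I_t, [exists k, [exists k',
        [&& level f s == diagram k, level f s.+1 == diagram k' & S k k']]]]].

Lemma count_interval u v : (v <= K)%N ->
  (\sum_(b < K | (b < v) && ~~ (b < u)) 1 = v - u)%N.
Proof.
move=> vK; transitivity (\sum_(b < v | ~~ (b < u)) 1)%N.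
  rewrite (big_ord_widen_cond K (fun b => ~~ (b < u)%N) (fun=> 1%N)) //.
  by apply: eq_bigl => b; rewrite andbC.
elim: v {vK} => [|v IH]; first by rewrite big_ord0.
by rewrite big_mkcond big_ord_recr -big_mkcond IH; case: (ltnP v u) => /=; lia.
Qed.

Lemma strip_sizeE k l : strip_size k l = #|diagram l :\: diagram k|.
Proof.
rewrite -sum1_card; under eq_bigl => c do rewrite !inE andbC.
rewrite -(pair_big_dep predT (fun a b : 'I_K => (b < rowlen l a) && ~~ (b < rowlen k a))%N
  (fun _ _ => 1%N)) /=.
by apply: eq_bigr => a _; rewrite count_interval ?rowlen_le.
Qed.

Lemma diagram_inj : injective diagram.
Proof.
move=> k l /setP e; apply: shapeP => i; apply/eqP; rewrite eqn_leq.
have [iK|Ki] := ltnP i K; last by rewrite !rowlen_out.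
have h (m n : row_shape K) : (forall b : 'I_K, (b < rowlen m i) -> (b < rowlen n i))%N -> (rowlen m i <= rowlen n i)%N.
  move=> mn; rewrite leqNgt; apply/negP => nm.
  have nK : (rowlen n i < K)%N by apply: leq_trans nm (rowlen_le _ _).
  by have := mn (Ordinal nK) nm; rewrite ltnn.
by apply/andP; split; apply: h => b; have := e (Ordinal iK, b); rewrite !inE /= => ->.
Qed.

Definition restrict t f : filling := [ffun c => if (f c < t)%N then f c else ord_max].

(** Inverse to [restrict] on tableaux: the unfilled cells of [l] receive the new value [t]. *)
Definition extend t l f : filling :=
  [ffun c => if (f c < K)%N then f c else if c \in diagram l then inord t else ord_max].

Lemma level_restrict t f s : (s <= t <= K)%N -> level (restrict t f) s = level f s.
Proof.
move=> st; apply/setP => c; rewrite !inE ffunE; case: ifP => //= h; lia.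
Qed.

Lemma level_restrictK t f : (t <= K)%N -> level (restrict t f) K = level f t.
Proof.
move=> tK; apply/setP => c; rewrite !inE ffunE; case: ifP => //= h; lia.
Qed.

Lemma is_tableau_restrict (S : rel (row_shape K)) t k l f : (t < K)%N ->
  is_tableau S t.+1 l f -> level f t == diagram k -> is_tableau S t k (restrict t f).
Proof.
move=> tK /and3P[_ _ /forallP ch] ek; apply/and3P; split.
- by apply/forallP => c; rewrite ffunE; case: ifP => [->|_] //=; rewrite eqxx orbT.
- by rewrite level_restrictK // ltnW.
- apply/forallP => s; have := ch (widen_ord (leqnSn t) s) => /=.
  by rewrite !level_restrict //; have := ltn_ord s; lia.
Qed.

Lemma is_tableau_lt (S : rel (row_shape K)) t l f c :
  is_tableau S t l f -> (f c < K)%N -> (f c < t)%N.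
Proof. by move=> /and3P[/forallP /(_ c) /orP[//|/eqP->]]; rewrite ltnn. Qed.

(** Induction on [t]: the cells with the largest allowed value form the last strip, and erasing them
    is a bijection onto the tableaux of the smaller shape. *)
Lemma tableau_sumE (S : rel (row_shape K)) (x : nat -> R) :
    (forall k l, S k l -> diagram k \subset diagram l) ->
  forall t l, (t <= K)%N -> tableau_sum S x t l =
    \sum_(f | is_tableau S t l f) \prod_(c in diagram l) x (f c).
Proof.
move=> Ssub; elim=> [|t IH] l tK /=.
  pose f0 : filling := [ffun=> ord_max].
  have lev0 : level f0 K = set0 by apply/setP => c; rewrite !inE ffunE ltnn.
  have dia0 : diagram [ffun=> ord0] = set0 by apply/setP => c; rewrite !inE rowlen0.
  have uniq_f0 m f : is_tableau S 0 m f -> f = f0.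
    move=> /and3P[/forallP h _ _]; apply/ffunP => c; rewrite ffunE.
    by apply: val_inj; have := h c => /= /eqP.
  have [->|l0] := eqVneq l [ffun=> ord0].
    rewrite (big_pred1 f0) => [|f]; last first.
      apply/idP/eqP => [/uniq_f0|->] //.
      apply/and3P; split; last by apply/forallP => -[].
        by apply/forallP => c; rewrite ffunE /=.
      by rewrite lev0 dia0.
    by rewrite dia0 big_set0.
  rewrite big_pred0 // => f; apply/negP => /[dup] /uniq_f0-> /and3P[_ /eqP e _].
  by case/eqP: l0; apply: diagram_inj; rewrite -e lev0 dia0.
(* The tableaux are sorted by the shape [k] of their cells with value below [t], unique by
   [diagram_inj]. *)
transitivity (\sum_(f | is_tableau S t.+1 l f) \sum_(k | S k l && (level f t == diagram k))
    \prod_(c in diagram l) x (f c)); last first.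
  apply: eq_bigr => f /and3P[/forallP ft /eqP fl /forallP ch].
  have /existsP[k /existsP[k' /and3P[/eqP ek /eqP ek' kk']]] := ch ord_max.
  have el : k' = l.
    apply: diagram_inj; rewrite -ek' -fl; apply/setP => c; rewrite !inE /=.
    by have /orP[h|/eqP->] := ft c; rewrite ?h ?(leq_trans h tK) // ltnn ltnNge tK.
  rewrite (big_pred1 k) // => m; rewrite ek (inj_eq diagram_inj) /= eq_sym.
  by case: eqP => [->|]; rewrite ?andbF // -el kk'.
rewrite (exchange_big_dep (fun k => S k l)) /=; last by move=> f k _ /andP[].
apply: eq_bigr => k Skl; rewrite IH ?(ltnW tK) // big_distrr /=.
have sub := Ssub _ _ Skl.
rewrite [RHS](reindex_onto (extend t l) (restrict t)) /=; last first.
  move=> f /andP[/[dup] ftab /and3P[_ /eqP fl _] /andP[_ /eqP ek]].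
  apply/ffunP => c; rewrite !ffunE -fl inE.
  have [ft|ft] := ltnP (f c) t; first by rewrite (ltn_trans ft tK).
  rewrite /= ltnn; case: ifP => fK; apply: val_inj; rewrite /= ?inordK ?(leqW tK) //.
    by apply/eqP; rewrite eqn_leq ft -ltnS (is_tableau_lt ftab fK).
  by have := ltn_ord (f c); lia.
apply: eq_big => [f|f ftab]; last first.
  have /and3P[_ /eqP fk _] := ftab.
  have [e1 e2] : (forall c, c \in diagram k -> extend t l f c = f c) /\
     (forall c, c \in diagram l :\: diagram k -> extend t l f c = t :> nat).
    rewrite -fk; split=> c; rewrite !inE ffunE; first by move=> ->.
    by move=> /andP[/negPf->]; rewrite inE => ->; rewrite inordK //; lia.
  rewrite [RHS](big_setID (diagram k)) /= (setIidPr sub) strip_sizeE -prodr_const mulrC.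
  by congr (_ * _); apply: eq_bigr => c ci; [rewrite e1 | rewrite e2].
apply/idP/idP => [ftab|/andP[/andP[ftab /andP[_ ek]] /eqP <-]]; last first.
  exact: is_tableau_restrict ftab ek.
have /and3P[/forallP ft /eqP fk /forallP ch] := ftab.
have lev s : (s <= t)%N -> level (extend t l f) s = level f s.
  move=> st; apply/setP => c; rewrite !inE ffunE; case: ifP => // fK.
  have no u : (t <= u)%N -> (u < s)%N = false by lia.
  have tf : (t <= f c)%N by apply: leq_trans (ltnW tK) _; rewrite leqNgt fK.
  by rewrite (no (f c)) //; case: ifP => _; rewrite ?inordK ?(leqW tK) // no // ltnW.
have levt : level f t = diagram k.
  rewrite -fk; apply/setP => c; rewrite !inE.
  by apply/idP/idP => [/leq_trans|/(is_tableau_lt ftab)//]; apply; apply: ltnW.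
have levl s : (t < s <= K)%N -> level (extend t l f) s = diagram l.
  move=> st; apply/setP => c; rewrite [LHS]inE ffunE.
  case: ifP => fK.
    have -> : c \in diagram l by apply: (subsetP sub); rewrite -fk inE.
    by have := is_tableau_lt ftab fK; lia.
  by case: ifP => _ /=; rewrite ?inordK; lia.
rewrite Skl lev // levt eqxx andbT; apply/andP; split; last first.
  apply/eqP/ffunP => c; rewrite !ffunE; case: (ltnP (f c) K) => fK.
    by rewrite (is_tableau_lt ftab fK).
  have -> : f c = ord_max by apply/val_inj/eqP; rewrite /= eqn_leq fK -ltnS ltn_ord.
  by rewrite ifF //; case: ifP => _ /=; rewrite ?inordK ?(leqW tK) ?ltnn // ltnNge ltnW.
rewrite andbT; apply/and3P; split.
- apply/forallP => c; rewrite ffunE; case: ifP => fK.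
    by rewrite ltnW // ltnS (is_tableau_lt ftab fK).
  by case: ifP => _ /=; rewrite ?inordK ?eqxx ?orbT //; lia.
- by rewrite levl ?leqnn ?andbT.
- apply/forallP => s; have [st|st] := ltnP s t.
    by have := ch (Ordinal st); rewrite !lev //= ltnW.
  have es : s = t :> nat by have := ltn_ord s; lia.
  apply/existsP; exists k; apply/existsP; exists l.
  by rewrite es lev // levt levl ?leqnn //= !eqxx.
Qed.

End Tableaux.

(** * Semistandard tableaux and the dual Cauchy identity over pairs of them *)

Section SemistandardTableaux.
Variables (R : comNzRingType) (K : nat).
Local Open Scope ring_scope.
Implicit Types (k l : row_shape K) (f g : filling K).

(** Extended by [K] outside the box, so that border cells need no separate treatment. *)
Definition entry f (i j : nat) : nat :=
  match insub i, insub j with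
  | Some a, Some b => f (a, b)
  | _, _ => K
  end.

(** Strictness is guarded because cells outside the tableau all carry [K]. The inequalities also
    force the support to be a Young diagram. *)
Definition semistandard f :=
  [forall a : 'I_K, forall b : 'I_K,
    ((entry f a.+1 b < K) ==> (entry f a b < entry f a.+1 b)) &&
    (entry f a b <= entry f a b.+1)]%N.

Definition cosemistandard f :=
  [forall a : 'I_K, forall b : 'I_K,
    ((entry f a b.+1 < K) ==> (entry f a b < entry f a b.+1)) &&
    (entry f a b <= entry f a.+1 b)]%N.

Lemma entryE f (c : cell K) : entry f c.1 c.2 = f c.
Proof. by rewrite /entry !valK; case: c. Qed.

Lemma entry_le f i j : (entry f i j <= K)%N.
Proof. by rewrite /entry; case: insub => // a; case: insub => // b; rewrite -ltnS. Qed.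

Lemma entry_lt f i j : (entry f i j < K)%N -> (i < K)%N && (j < K)%N.
Proof.
rewrite /entry; case: insubP => [a -> _|]; last by rewrite ltnn.
by case: insubP => [b -> _|]; rewrite ?ltnn.
Qed.

Lemma semistandardP f :
  reflect (forall i j, ((entry f i.+1 j < K) ==> (entry f i j < entry f i.+1 j)) /\
    (entry f i j <= entry f i j.+1))%N (semistandard f).
Proof.
apply: (iffP forallP) => h => [i j|a]; last by apply/forallP => b; apply/andP.
have [/andP[iK jK]|out] := boolP ((i < K) && (j < K))%N.
  by have /forallP/(_ (Ordinal jK))/andP := h (Ordinal iK).
have o u v : (i <= u)%N -> (j <= v)%N -> entry f u v = K.
  move=> iu jv; apply/eqP; rewrite eqn_leq entry_le leqNgt.
  by apply/negP => /entry_lt; lia.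
by rewrite !o ?ltnn.
Qed.

Lemma cosemistandardP f :
  reflect (forall i j, ((entry f i j.+1 < K) ==> (entry f i j < entry f i j.+1)) /\
    (entry f i j <= entry f i.+1 j))%N (cosemistandard f).
Proof.
apply: (iffP forallP) => h => [i j|a]; last by apply/forallP => b; apply/andP.
have [/andP[iK jK]|out] := boolP ((i < K) && (j < K))%N.
  by have /forallP/(_ (Ordinal jK))/andP := h (Ordinal iK).
have o u v : (i <= u)%N -> (j <= v)%N -> entry f u v = K.
  move=> iu jv; apply/eqP; rewrite eqn_leq entry_le leqNgt.
  by apply/negP => /entry_lt; lia.
by rewrite !o ?ltnn.
Qed.

(** Turns inequalities between row lengths of level sets into inequalities between entries. *)
Lemma rowlen_level f s k i j : (s <= K)%N -> level f s = diagram k ->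
  (j < rowlen k i)%N = (entry f i j < s)%N.
Proof.
move=> sK /setP e; have [/andP[iK jK]|out] := boolP ((i < K) && (j < K))%N.
  by have := e (Ordinal iK, Ordinal jK); rewrite !inE -entryE /= => <-.
have -> : (entry f i j < s)%N = false.
  by apply/negP => h; case/negP: out; apply: entry_lt (leq_trans h sK).
apply/negbTE; rewrite -leqNgt; have := rowlen_le k i; have := @rowlen_out _ k i.
move: out; lia.
Qed.

(** The row lengths are the cardinalities of the rows of [A]: a left-justified row with [n] cells
    occupies the first [n] columns. *)
Lemma diagram_of (A : {set cell K}) :
  (forall a (b b' : 'I_K), b <= b' -> (a, b') \in A -> (a, b) \in A)%N ->
  exists k, A = diagram k.
Proof.
move=> init; pose D a := [set b : 'I_K | (a, b) \in A].
have DK a : (#|D a| < K.+1)%N by rewrite ltnS -[X in (_ <= X)%N]card_ord max_card.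
have cardlt (n : nat) : (n <= K)%N -> #|[set b : 'I_K | (b < n)%N]| = n.
  move=> nK; rewrite -sum1_card; under eq_bigl => b do rewrite inE.
  by rewrite -(big_ord_widen K (fun=> 1%N)) // sum1_card card_ord.
exists [ffun a => inord #|D a|]; apply/setP => -[a b].
rewrite inE /= rowlenE ffunE inordK //; apply/idP/idP => h.
  rewrite -[b.+1]cardlt ?ltn_ord //; apply: subset_leq_card; apply/subsetP => b'.
  by rewrite !inE ltnS => bb'; apply: init h.
apply: contraTT h => h; rewrite -leqNgt -[X in (_ <= X)%N]cardlt ?(ltnW (ltn_ord b)) //.
apply: subset_leq_card; apply/subsetP => b'; rewrite !inE ltnNge.
by apply: contraL => bb'; apply: contra h; apply: init.
Qed.

Lemma diagram_of_level f s : (forall i j, entry f i j <= entry f i j.+1)%N ->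
  exists k, level f s = diagram k.
Proof.
move=> mono; apply: diagram_of => a b b' bb'; rewrite !inE -!entryE /=.
apply: leq_ltn_trans; elim: (b' : nat) bb' => [|n IH]; first by case: (b : nat).
by rewrite leq_eqVlt => /predU1P[->//|/IH/leq_trans]; apply.
Qed.

Lemma leq_ltP (m n : nat) : (forall j, j < m -> j < n)%N -> (m <= n)%N.
Proof. by case: m => // m; apply. Qed.

Lemma is_tableauP (S : rel (row_shape K)) l f :
  reflect (level f K = diagram l /\ forall s, (s < K)%N -> exists k k',
    [/\ level f s = diagram k, level f s.+1 = diagram k' & S k k'])
    (is_tableau S K l f).
Proof.
apply: (iffP and3P) => [[_ /eqP fl /forallP ch]|[fl ch]]; split=> //.
- move=> s sK; have /existsP[k /existsP[k' /and3P[/eqP ? /eqP ? ?]]] := ch (Ordinal sK).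
  by exists k, k'.
- by apply/forallP => c; rewrite orbC -leq_eqVlt -ltnS.
- exact/eqP.
- apply/forallP => s; have [k [k' [ek ek' kk']]] := ch s (ltn_ord s).
  by apply/existsP; exists k; apply/existsP; exists k'; rewrite ek ek' !eqxx.
Qed.

(** The strip condition, read at the level of an entry, compares that entry with its neighbours
    above and to the left. *)
Lemma is_tableau_hstrip l f :
  is_tableau (@hstrip K) K l f = semistandard f && (level f K == diagram l).
Proof.
apply/is_tableauP/andP => [[fl ch]|[/semistandardP ss /eqP fl]]; split=> //.
- apply/semistandardP => i j; split.
    apply/implyP => fK; have [k [k' [ek ek' /hstripP kk']]] := ch _ fK.
    rewrite -(rowlen_level i j (ltnW fK) ek).
    apply: leq_trans (proj2 (kk' i)).
    by rewrite (rowlen_level i.+1 j fK ek').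
  have := entry_le f i j.+1; rewrite leq_eqVlt => /predU1P[->|fK].
    exact: entry_le.
  have [k [k' [ek ek' /hstripP kk']]] := ch _ fK.
  rewrite -ltnS -(rowlen_level i j fK ek'); apply: (@ltnW j.+1).
  by rewrite (rowlen_level i j.+1 fK ek').
- exact/eqP.
- move=> s sK.
  have [k ek] := diagram_of_level s (fun i j => proj2 (ss i j)).
  have [k' ek'] := diagram_of_level s.+1 (fun i j => proj2 (ss i j)).
  exists k, k'; split=> //; apply/hstripP => i; split; apply: leq_ltP => j.
    by rewrite (rowlen_level i j (ltnW sK) ek) (rowlen_level i j sK ek') => /ltnW.
  rewrite (rowlen_level i j (ltnW sK) ek) (rowlen_level i.+1 j sK ek') => fs.
  have /implyP/(_ (leq_trans fs sK)) := proj1 (ss i j).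
  by move=> h; apply: leq_trans h _.
Qed.

(** Weak increase down the columns comes from the shapes being partitions, strict increase along the
    rows from each row growing by at most one cell per level. *)
Lemma is_tableau_vstrip l f :
  is_tableau (@vstrip K) K l f = cosemistandard f && (level f K == diagram l).
Proof.
apply/is_tableauP/andP => [[fl ch]|[/cosemistandardP ss /eqP fl]]; split=> //.
- apply/cosemistandardP => i j; split.
    apply/implyP => fK; have [k [k' [ek ek' /vstripP[_ _ kk']]]] := ch _ fK.
    rewrite -(rowlen_level i j (ltnW fK) ek) -ltnS.
    have /andP[_] := kk' i; apply: leq_trans.
    by rewrite (rowlen_level i j.+1 fK ek').
  have := entry_le f i.+1 j; rewrite leq_eqVlt => /predU1P[->|fK].
    exact: entry_le.
  have [k [k' [ek ek' /vstripP[_ /partition_shapeP pk' _]]]] := ch _ fK.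
  rewrite -ltnS -(rowlen_level i j fK ek'); apply: leq_trans (pk' i).
  by rewrite (rowlen_level i.+1 j fK ek').
- exact/eqP.
- move=> s sK.
  have mono i j : (entry f i j <= entry f i j.+1)%N.
    have := entry_le f i j.+1; rewrite leq_eqVlt => /predU1P[->|fK].
      exact: entry_le.
    by have /implyP/(_ fK)/ltnW := proj1 (ss i j).
  have part t m : (t <= K)%N -> level f t = diagram m -> partition_shape m.
    move=> tK em; apply/partition_shapeP => i; apply: leq_ltP => j.
    rewrite !(rowlen_level _ j tK em); apply: leq_ltn_trans.
    exact: (proj2 (ss i j)).
  have [k ek] := diagram_of_level s mono.
  have [k' ek'] := diagram_of_level s.+1 mono.
  exists k, k'; split=> //; apply/vstripP; split.
  - exact: part (ltnW sK) ek.
  - exact: part sK ek'.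
  move=> i; apply/andP; split; apply: leq_ltP => j.
    by rewrite (rowlen_level i j (ltnW sK) ek) (rowlen_level i j sK ek') => /ltnW.
  rewrite (rowlen_level i j sK ek'); case: j => // j fs.
  rewrite ltnS (rowlen_level i j (ltnW sK) ek).
  have /implyP/(_ (leq_trans fs sK)) := proj1 (ss i j).
  by move=> h; apply: leq_trans h _.
Qed.

Definition tableau_pair (p : filling K * filling K) :=
  [&& semistandard p.1, cosemistandard p.2 & level p.1 K == level p.2 K].

(** This is [dual_cauchy] with [K] variables of each kind. The common shape [l] is determined by the
    support of the tableaux and disappears from the sum. *)
Lemma dual_cauchy_tableaux (x y : nat -> R) :
  \sum_(p | tableau_pair p) \prod_(c in level p.1 K) (x (p.1 c) * y (p.2 c)) =
  \prod_(i < K) \prod_(j < K) (1 + x i * y j).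
Proof.
rewrite -(dual_cauchy x y (leqnn K) (leqnn K)).
have hsub k l : hstrip k l -> diagram k \subset diagram l.
  move=> /hstripP h; apply/subsetP => c; rewrite !inE => /leq_trans; apply.
  exact: (proj1 (h _)).
have vsub k l : vstrip k l -> diagram k \subset diagram l.
  move=> /vstripP[_ _ h]; apply/subsetP => c; rewrite !inE => /leq_trans; apply.
  by have /andP[] := h c.1.
symmetry; transitivity (\sum_l
  \sum_(p : filling K * filling K | [&& semistandard p.1, cosemistandard p.2,
     level p.1 K == diagram l & level p.2 K == diagram l])
   \prod_(c in level p.1 K) (x (p.1 c) * y (p.2 c))).
  apply: eq_bigr => l _; rewrite (tableau_sumE x hsub) // (tableau_sumE y vsub) //.
  rewrite big_distrlr /= pair_big_dep /=; apply: eq_big => [[f g]|[f g]] /=.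
    rewrite is_tableau_hstrip is_tableau_vstrip.
    by case: semistandard; case: cosemistandard; rewrite ?andbF.
  rewrite is_tableau_hstrip => /andP[/andP[_ /eqP->] _].
  by rewrite big_split.
rewrite (exchange_big_dep tableau_pair) /=; last first.
  by move=> l p _ /and4P[h v /eqP e /eqP e']; rewrite /tableau_pair h v e e' /=.
apply: eq_bigr => p /and3P[/[dup] /semistandardP ss -> -> /eqP e].
have [l el] := diagram_of_level K (fun i j => proj2 (ss i j)).
rewrite (big_pred1 l) // => m; rewrite -e el (inj_eq (@diagram_inj K)) andbb /=.
exact: eq_sym.
Qed.

End SemistandardTableaux.

(* Imported only here because it shadows names of [finset] and [fintype]. *)
From mathcomp Require Import boolp classical_sets cardinality finmap.

(** * Closed form of the cluster variables *)

Section ClusterVariables.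
Local Open Scope ring_scope.

Definition mon (a b : nat) : 'X_{1..2} :=
  [multinom if i == v0 then a else b | i < 2].

Definition ymon (a b : nat) : {mpoly int[2]} := 'X_[mon a b].

Lemma ymonE a b : ymon a b = 'X_v0 ^+ a * 'X_v1 ^+ b.
Proof.
rewrite /ymon mpolyXE_id big_ord_recl big_ord1 !mnmE.
by congr (_ ^+ _ * 'X_ _ ^+ _); apply: val_inj.
Qed.

Definition Fprod (k : nat) : {mpoly int[2]} :=
  \prod_(i < k) \prod_(j < i.+1) (1 + ymon j.+1 j).

(** The inner product of index [k + 1] is that of index [k] times one more binomial. *)
Lemma Fprod_rec k : Fprod k.+2 * Fprod k = Fprod k.+1 ^+ 2 * (1 + ymon k.+2 k.+1).
Proof.
rewrite /Fprod !big_ord_recr /=.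
by set A := \prod_(i < k) _; set B := \prod_(i < k) _; ring.
Qed.

Lemma binom_neq0 j : 1 + ymon j.+1 j != 0.
Proof.
have nz : mon j.+1 j != 0%MM.
  by apply/eqP => e; have := congr1 (fun m : 'X_{1..2} => m v0) e; rewrite mnmE mnm0E.
apply/eqP => /(congr1 (mcoeff 0%MM)) /eqP.
by rewrite mcoeffD mcoeff1 mcoeffX mcoeff0 eqxx (negbTE nz).
Qed.

Lemma Fprod_neq0 k : Fprod k != 0.
Proof. by apply/prodf_neq0 => i _; apply/prodf_neq0 => j _; apply: binom_neq0. Qed.

(** Simultaneous induction on all labels: the vertex mutated last carries the newest variable, the
    one mutated next the preceding variable. With the truncated [n.-1] both are [Fprod 0 = 1] at the
    start. *)
Lemma seed_labels n :
  [/\ (seed n).2 (mutated_vertex n) = tofrac (Fprod n),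
      (seed n).2 (mutated_vertex n.+1) = tofrac (Fprod n.-1)
    & forall i, (seed n).2 (inr i) = tofrac 'X_i].
Proof.
elim: n => [|n [IH1 IH2 IH3]].
  by split=> //=; rewrite /Fprod big_ord0 rmorph1.
have neq : (mutated_vertex n == mutated_vertex n.+1) = false.
  by rewrite /mutated_vertex /=; case: (odd n).
have step u : (seed n.+1).2 u = mutate_labels (seed n).1 (seed n).2 (mutated_vertex n.+1) u by [].
split; rewrite ?step.
- rewrite /mutate_labels eqxx IH2.
  (* The first mutation is computed on [conifold] itself; [seedQ] describes the quivers after at
     least one mutation. *)
  case: n IH1 IH2 IH3 neq step => [|n] IH1 IH2 IH3 neq _.
    rewrite /Fprod big_ord0 !big_ord_recl big_ord0 /= rmorph1 divr1.
    rewrite big_sumType /= !big_ord_recl !big_ord0 /=.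
    rewrite [X in _ + X]big_sumType /= !big_ord_recl !big_ord0 /=.
    rewrite !expr1n !expr0 !expr1 !mulr1 !mul1r.
    by rewrite rmorphD /= rmorph1 ymonE expr1 expr0 mulr1.
  have F0 : tofrac (Fprod n) != 0 :> label by rewrite tofrac_eq0 Fprod_neq0.
  (* Multiplying by the old label [Fprod n] turns the exchange relation into [Fprod_rec]. *)
  rewrite seedQ; apply: (mulIf F0); rewrite mulfVK // -rmorphM Fprod_rec.
  move: (seed n.+1).2 IH1 IH3 => l; rewrite /mutated_vertex /= => IH1 IH3.
  have o1 : lift ord0 ord0 = v1 by apply: val_inj.
  rewrite !big_sumType /= !big_ord_recl !big_ord0 /= !IH3 o1 -/v0 negbK.
  have -> : ymon n.+2 n.+1 = 'X_v0 ^+ n.+2 * 'X_v1 ^+ n.+1 by rewrite ymonE.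
  rewrite rmorphM rmorphXn rmorphD rmorph1 rmorphM !rmorphXn /=.
  by case: (odd n) IH1 => /= ->; rewrite !expr0; ring.
- have -> : mutated_vertex n.+2 = mutated_vertex n.
    by rewrite /mutated_vertex /= negbK.
  by rewrite /mutate_labels neq.
- by move=> i; rewrite step /mutate_labels /= IH3.
Qed.

Lemma Fprod_cluster k : tofrac (Fprod k) = cluster_variable k.
Proof. by have [<- _ _] := seed_labels k. Qed.

Lemma FpolyE k : Fpoly k = Fprod k.
Proof.
rewrite /Fpoly; apply: xget_unique => [|p]; first exact: Fprod_cluster.
by rewrite /= -Fprod_cluster => /eqP; rewrite tofrac_eq => /eqP.
Qed.

End ClusterVariables.

(** * The change of exponents and the stable variables *)

Section Stabilization.
Local Open Scope ring_scope.

(** [f] marks the factors from which the monomial is taken. Equal monomials are not collected, so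
    that the exponent map can act on each choice. *)
Lemma prod_add_mpolyX n (I : finType) (Q : pred I) (M : I -> 'X_{1..n}) :
  \prod_(t | Q t) (1 + 'X_[M t]) =
  \sum_(f in family (fun t b => b ==> Q t)) 'X_[\sum_(t | f t) M t]
  :> {mpoly int[n]}.
Proof.
under eq_bigr => t _.
  rewrite (_ : 1 + 'X_[M t] = \sum_(b : bool) (if b then 'X_[M t] else 1));
    last by rewrite big_bool addrC.
  over.
rewrite big_mkcond /=.
have E t : (if Q t then \sum_(b : bool) (if b then 'X_[M t] else 1) else 1) =
    \sum_(b | b ==> Q t) (if b then 'X_[M t] else 1) :> {mpoly int[n]}.
  rewrite [RHS]big_mkcond [in RHS]big_bool /=.
  by case: (Q t); rewrite ?big_bool //= add0r.
under eq_bigr => t _ do rewrite E.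
rewrite bigA_distr_big_dep; apply: eq_bigr => f _.
rewrite -big_mkcond /=.
by elim/big_rec2: _ => [|t p m _ ->]; rewrite ?mpolyX0 ?mpolyXD.
Qed.

Lemma expoD m1 m2 : expo (m1 + m2) = expo m1 + expo m2.
Proof. by apply/matrixP => i j; rewrite !mxE mnmDE PoszD. Qed.

Lemma expo0 : expo 0%MM = 0.
Proof. by apply/matrixP => i j; rewrite !mxE mnm0E. Qed.

Lemma expo_sum (I : Type) (r : seq I) (P : pred I) (M : I -> 'X_{1..2}) :
  expo (\sum_(i <- r | P i) M i)%MM = \sum_(i <- r | P i) expo (M i).
Proof. exact: (big_morph expo expoD expo0). Qed.

Lemma expo_inj : injective expo.
Proof.
move=> m1 m2 e; apply/mnmP => i.
by have := congr1 (fun A : 'cV[int]_2 => A i 0) e; rewrite !mxE => -[].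
Qed.

Lemma col2P (u v : 'cV[int]_2) : u v0 0 = v v0 0 -> u v1 0 = v v1 0 -> u = v.
Proof.
move=> h0 h1; apply/matrixP => i j; rewrite (ord1 j).
by case: (ord2P i) => ->.
Qed.

Lemma stable_mxM k (u : 'cV[int]_2) : (0 < k)%N ->
  (stable_mx k *m u) v0 0 = k%:Z * u v0 0 - k.+1%:Z * u v1 0 /\
  (stable_mx k *m u) v1 0 = (k%:Z - 1) * u v0 0 - k%:Z * u v1 0.
Proof.
move=> k0; rewrite stable_mxE // !mxE !big_ord_recl !big_ord0 !mxE /=.
have -> : lift ord0 ord0 = v1 by apply: val_inj.
by rewrite -/v0 !addr0 !mulNr.
Qed.

(** The matrix has trace 0 and determinant -1, hence square 1. This gives injectivity on
    exponents. *)
Lemma stable_mxK k : (0 < k)%N -> involutive (fun u : 'cV[int]_2 => stable_mx k *m u).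
Proof.
move=> k0 u; have [a b] := stable_mxM u k0.
have [c d] := stable_mxM (stable_mx k *m u) k0.
by apply: col2P; rewrite ?c ?d a b; ring.
Qed.

Lemma stable_mx_mon k s : (s < k)%N ->
  stable_mx k *m expo (mon (k.-1 - s).+1 (k.-1 - s)) = expo (mon s.+1 s).
Proof.
move=> sk; have k0 : (0 < k)%N by apply: leq_ltn_trans sk.
have [a b] := stable_mxM (expo (mon (k.-1 - s).+1 (k.-1 - s))) k0.
have e : (k.-1 - s)%N%:Z = k%:Z - 1 - s%:Z by lia.
apply: col2P; rewrite ?a ?b !mxE !mnmE /= -[(_ - s).+1%:Z]/(1 + (k.-1 - s)%N%:Z) e; lia.
Qed.

Definition Gprod (k : nat) : {mpoly int[2]} :=
  \prod_(p : 'I_k * 'I_k | (p.1 + p.2 < k)%N) (1 + ymon (p.1 + p.2).+1 (p.1 + p.2)).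

(** Setting [u = k - 1 - i] and [v = i - j] gives [j = k - 1 - (u + v)], the form in which
    [stable_mx_mon] applies to each factor. *)
Lemma Fprod_pairs k :
  Fprod k = \prod_(p : 'I_k * 'I_k | (p.1 + p.2 < k)%N)
    (1 + ymon (k.-1 - (p.1 + p.2)).+1 (k.-1 - (p.1 + p.2))).
Proof.
rewrite -(pair_big_dep predT (fun i j : 'I_k => (i + j < k)%N)
  (fun i j : 'I_k => 1 + ymon (k.-1 - (i + j)).+1 (k.-1 - (i + j)))) /=.
rewrite /Fprod (reindex_inj rev_ord_inj) /=; apply: eq_bigr => i _.
rewrite (reindex_inj rev_ord_inj) /=.
pose h j := 1 + ymon (k.-1 - (i + j)).+1 (k.-1 - (i + j)).
transitivity (\prod_(j < (k - i.+1).+1) h j).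
  apply: eq_bigr => j _; rewrite /h; have := ltn_ord i; have := ltn_ord j.
  by move=> ji ik; congr (1 + ymon _.+1 _); lia.
rewrite (big_ord_widen k h); last by have := ltn_ord i; lia.
by apply: eq_bigl => j; have := ltn_ord i; lia.
Qed.

(** The exponents [W f] may repeat. As the exponent map is injective, at most one monomial of
    [Fprod k] is sent to [b], and its coefficient counts the [f] producing it. *)
Lemma Fstable_sum k b (I : finType) (A : pred I) (W : I -> 'X_{1..2}) :
  (0 < k)%N -> Fprod k = \sum_(f in A) 'X_[W f] ->
  Fstable k b = \sum_(f in A) (stable_mx k *m expo (W f) == b)%:R.
Proof.
move=> k0 e; rewrite /Fstable FpolyE.
have Sinj := inv_inj (stable_mxK k0).
have [[m0 <-]|nm] := pselect (exists m, stable_mx k *m expo m = b).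
  have E m : (stable_mx k *m expo m == stable_mx k *m expo m0) = (m == m0).
    by rewrite (inj_eq Sinj) (inj_eq expo_inj).
  under eq_bigl => m do rewrite E.
  under [RHS]eq_bigr => m _ do rewrite E.
  transitivity (Fprod k)@_m0; last first.
    by rewrite e raddf_sum /=; apply: eq_bigr => f _; rewrite mcoeffX.
  have [i|ni] := boolP (m0 \in msupp (Fprod k)).
    by rewrite -big_filter filter_pred1_uniq ?msupp_uniq // big_seq1.
  rewrite (memN_msupp_eq0 ni) big_seq_cond big1 // => m /andP[im /eqP em].
  by rewrite em (negPf ni) in im.
have E m : (stable_mx k *m expo m == b) = false.
  by apply/eqP => em; apply: nm; exists m.
rewrite big_pred0 => [|m]; last exact: E.
by rewrite big1 // => f _; rewrite E.
Qed.

(** One family of exponents in the natural numbers expands both [Fstable k] and [Gprod k];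
    nonnegativity and the coefficients are read off from it. *)
Lemma FstableE k b : (0 < k)%N ->
  exists (I : finType) (A : pred I) (W : I -> 'X_{1..2}),
    Fstable k b = \sum_(f in A) (expo (W f) == b)%:R /\
    Gprod k = \sum_(f in A) 'X_[W f].
Proof.
move=> k0; pose Q (p : 'I_k * 'I_k) := (p.1 + p.2 < k)%N.
exists {ffun 'I_k * 'I_k -> bool}, (family (fun p b => b ==> Q p)).
exists (fun f : {ffun 'I_k * 'I_k -> bool} =>
  \sum_(p : 'I_k * 'I_k | f p) mon (p.1 + p.2).+1 (p.1 + p.2))%MM; split.
  rewrite (Fstable_sum b k0 (etrans (Fprod_pairs k) (prod_add_mpolyX _ _))).
  apply: eq_bigr => f /familyP fQ; rewrite !expo_sum mulmx_sumr.
  congr ((nat_of_bool (_ == b))%:R).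
  apply: eq_bigr => p fp; apply: stable_mx_mon.
  by have := fQ p; rewrite unfold_in fp.
exact: prod_add_mpolyX.
Qed.

Lemma Fstable_power_series k : (0 < k)%N -> is_power_series (Fstable k).
Proof.
move=> k0 b [i bi]; have [I [A [W [-> _]]]] := FstableE b k0.
by apply: big1 => f _; case: eqP => // e; move: bi; rewrite -e mxE.
Qed.

Lemma Fstable_coef k m : (0 < k)%N -> Fstable k (expo m) = (Gprod k)@_m.
Proof.
move=> k0; have [I [A [W [-> ->]]]] := FstableE (expo m) k0.
rewrite raddf_sum /=; apply: eq_bigr => f _.
by rewrite mcoeffX (inj_eq expo_inj).
Qed.

End Stabilization.

(** * Truncation to a box *)

Section Truncation.
Local Open Scope ring_scope.

Definition box_prod (k : nat) : {mpoly int[2]} :=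
  \prod_(p : 'I_k * 'I_k) (1 + ymon (p.1 + p.2).+1 (p.1 + p.2)).

(** A choice using a factor with [u + v >= k] has [y_1]-exponent at least [k], so it cannot produce
    [m]. *)
Lemma Gprod_box k (m : 'X_{1..2}) : (m v1 < k)%N -> (Gprod k)@_m = (box_prod k)@_m.
Proof.
move=> mk; rewrite /Gprod /box_prod !prod_add_mpolyX !raddf_sum /=.
rewrite big_mkcond [RHS]big_mkcond /=; apply: eq_bigr => f _.
have -> : f \in family (fun=> implb^~ true).
  by apply/familyP => t; rewrite unfold_in implybT.
case: ifP => // /negbT/familyP nf; rewrite mcoeffX; case: eqP => // e.
case: nf => p; rewrite unfold_in; apply/implyP => fp.
move: mk; rewrite -e mnm_sumE (bigD1 p) //= mnmE /=; lia.
Qed.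

End Truncation.

(** * Altered rows of simple partitions as pairs of cut positions *)

Section RowCuts.
Local Open Scope classical_set_scope.

(** [m] and [n] count the white stones kept on the left and on the right; the black stones have the
    same cuts. *)
Definition row_cut (P : set stone) (jr : nat * nat) (m n : nat) : Prop :=
  forall s, row_stones jr s -> P s <-> (if sside s is Left then m else n) < spos s.

Lemma spos_bounded (A : set stone) : finite_set A ->
  exists N, forall s, A s -> spos s <= N.
Proof.
case/finite_seqP => r ->; exists (\max_(s <- r) spos s) => s sr.
by rewrite (big_rem s) //= leq_maxl.
Qed.

Lemma finite_row_le (jr : nat * nat) N : finite_set [set s | row_stones jr s /\ spos s <= N].
Proof.
pose F col d := Stone col d jr.1 jr.2 @` `I_N.+1.
have fF col d : finite_set (F col d) by apply/finite_image/finite_II.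
apply: (@sub_finite_set _ _ (F White Left `|` F White Right `|` (F Black Left `|` F Black Right))).
  move=> [col d j r c] [[_ e] /= cN]; have [<- <-] : jr.1 = j /\ jr.2 = r by rewrite -e.
  by case: col {e}; case: d; [left; left|left; right|right; left|right; right]; exists c.
by rewrite !finite_setU.
Qed.

Lemma fset_set_seq (T : choiceType) (A : set T) (r : seq T) :
  uniq r -> (forall x, A x <-> x \in r) -> perm_eq (fset_set A) r.
Proof.
move=> ur Ar; have eA : A = [set` r] by apply/seteqP; split=> x /Ar.
have fA : finite_set A by rewrite eA; apply/finite_seqP; exists r.
by apply: uniq_perm => // x; rewrite in_fset_set // eA mem_setE.
Qed.

Lemma row_stonesE jr s : row_stones jr s <->
  [/\ AD_rows jr, slayer s = jr.1, srow s = jr.2 & 0 < spos s].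
Proof.
case: s => col d j r c; case: jr => j' r'; split.
  by case=> -[/= h c0] [<- <-].
by case=> /= h -> -> c0; split.
Qed.

Lemma eventual_cut (Q : nat -> Prop) N :
    (forall c d, 0 < c -> c <= d -> Q c -> Q d) -> (forall c, N < c -> Q c) ->
  exists m, forall c, 0 < c -> Q c <-> m < c.
Proof.
move=> up; elim: N => [|N IH] large; first by exists 0 => c c0; split=> // _; apply: large.
have [QN|nQN] := pselect (Q N.+1).
  by apply: IH => c; rewrite leq_eqVlt => /predU1P[<- //|]; apply: large.
exists N.+1 => c c0; split; last exact: large.
by move=> Qc; rewrite ltnNge; apply/negP => cN; apply: nQN; apply: up Qc.
Qed.

Section Cut.
Variables (P : set stone) (jr : nat * nat) (m n : nat).
Hypotheses (jrP : AD_rows jr) (cut : row_cut P jr m n).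

Let bound d := if d is Left then m else n.

Lemma row_stones_Stone col d c : 0 < c -> row_stones jr (Stone col d jr.1 jr.2 c).
Proof. by move=> c0; apply/row_stonesE. Qed.

Lemma cutE col d c : 0 < c -> P (Stone col d jr.1 jr.2 c) <-> bound d < c.
Proof. by move=> c0; apply: cut; apply: row_stones_Stone. Qed.

Lemma cut_altered : altered P jr.
Proof.
split=> //; exists (Stone White Left jr.1 jr.2 m.+1); split.
  by apply/cutE.
exact: row_stones_Stone.
Qed.

Lemma cut_infinite : infinite_set (white_stones jr `&` P).
Proof.
move=> /spos_bounded[N h].
have /h /= : (white_stones jr `&` P) (Stone White Left jr.1 jr.2 (maxn N m).+1).
  by split; [split=> //; apply: row_stones_Stone | apply/cutE => //=; rewrite ltnS leq_maxr].
by rewrite ltnNge leq_maxl.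
Qed.

Lemma cut_cofinite : finite_set (row_stones jr `\` P).
Proof.
apply: sub_finite_set (finite_row_le jr (maxn m n)) => s [rs nPs]; split=> //.
rewrite leqNgt; apply/negP => h; apply: nPs; apply/cut => //.
by apply: leq_ltn_trans h; case: sside; rewrite ?leq_maxl ?leq_maxr.
Qed.

Lemma cut_simple : simple_row P jr.
Proof.
move=> _; split; first exact: cut_infinite.
- move=> s t u [[rs ws] Ps] [rt wt] [[ru wu] Pu] st tu; split=> //; apply/cut => //.
  move/cut: Ps => /(_ rs); move/cut: Pu => /(_ ru); move: st tu; rewrite /left_of.
  case: (sside t) => /=.
    by case: (sside s) => // st _ _ ms; apply: ltn_trans st.
  by case: (sside u) => //; case: (sside s) => // _ ut nu _; apply: ltn_trans ut.
move=> [col d j r c] [[/row_stonesE[_ /= -> -> c0] /= ->] ex].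
apply/cutE => //; apply/(cutE White) => //; apply: ex; last exact: on_top_outer.
by split=> //; apply: row_stones_Stone.
Qed.

Lemma cut_count : #|` fset_set (white_stones jr `\` P)| = m + n.
Proof.
pose F d (k : nat) := [seq Stone White d jr.1 jr.2 c | c <- iota 1 k].
have uF d k : uniq (F d k) by rewrite map_inj_uniq ?iota_uniq // => c c' [].
have mF d k s : s \in F d k <-> s = Stone White d jr.1 jr.2 (spos s) /\ 0 < spos s <= k.
  split=> [/mapP[c + ->]|[-> h]]; first by rewrite mem_iota => h; split=> //; lia.
  by apply: map_f; rewrite mem_iota; move: h => /=; lia.
have -> : m + n = size (F Left m ++ F Right n) by rewrite size_cat !size_map !size_iota.
apply: perm_size; apply: fset_set_seq.
  rewrite cat_uniq !uF andbT /=; apply/hasPn => s /mF[-> _].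
  by apply/negP => /mF[].
move=> s; rewrite mem_cat; split.
  case: s => col d j r c [[/row_stonesE[_ /= -> -> c0] /= ->]].
  move=> nP; have {nP} : ~ bound d < c by move/(cutE White d c0).
  move/negP; rewrite -leqNgt => h; apply/orP.
  by case: d h => /= h; [left|right]; apply/mF; rewrite /= c0 h.
case/orP => /mF[-> /andP[c0 h]]; (split; first by split=> //; apply: row_stones_Stone).
  by move/(cutE White Left c0) => /=; rewrite ltnNge h.
by move/(cutE White Right c0) => /=; rewrite ltnNge h.
Qed.

End Cut.

(** Cofiniteness and consecutiveness give each side a threshold for white stones. Stability and the
    absence of exposed black stones give the black stones the same threshold. *)
Lemma simple_partition_cut P jr : is_simple_partition P -> altered P jr ->
  exists m n, row_cut P jr m n.
Proof.
move=> [[sub st fin] simple] /[dup] alt [jrP _].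
have [_ /spos_bounded[N hN]] := fin jr alt.
have [_ cons expo] := simple jr jrP alt.
have rs col d c : 0 < c -> row_stones jr (Stone col d jr.1 jr.2 c).
  exact: row_stones_Stone.
have ws d c : 0 < c -> white_stones jr (Stone White d jr.1 jr.2 c).
  by move=> c0; split=> //; apply: rs.
have large s : row_stones jr s -> N < spos s -> P s.
  move=> rss Ns; apply: contrapT => nP.
  by have := hN s (conj rss nP); rewrite leqNgt Ns.
have ex d : exists m, forall c, 0 < c -> P (Stone White d jr.1 jr.2 c) <-> m < c.
  apply: (@eventual_cut (fun c => P (Stone White d jr.1 jr.2 c)) N); last first.
    by move=> c Nc; apply: large => //; apply: rs; apply: leq_ltn_trans Nc.
  move=> c c' c0; rewrite leq_eqVlt => /predU1P[<- //|cc'] Pc.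
  have c'0 := ltn_trans c0 cc'.
  (* A removed white stone far inside the row: the stone at [c'] lies between it and the removed
     stone at [c]. *)
  pose u := Stone White d jr.1 jr.2 (maxn N c').+1.
  have Pu : P u by apply: large; [apply: rs | rewrite ltnS leq_maxl].
  have tu : c' < spos u by rewrite /= ltnS leq_maxr.
  case: d Pc @u Pu tu => Pc u Pu tu.
    by have [] := cons _ (Stone White Left jr.1 jr.2 c') u (conj (ws _ _ c0) Pc)
      (ws _ _ c'0) (conj (ws _ _ (ltn0Sn _)) Pu) cc' tu.
  by have [] := cons u (Stone White Right jr.1 jr.2 c') _ (conj (ws _ _ (ltn0Sn _)) Pu)
      (ws _ _ c'0) (conj (ws _ _ c0) Pc) tu cc'.
have [[m hm] [n hn]] := (ex Left, ex Right).
exists m, n => -[col d j r c] /row_stonesE[_ /= -> -> c0].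
have hw : P (Stone White d jr.1 jr.2 c) <-> (if d is Left then m else n) < c.
  by case: d; [apply: hm | apply: hn].
have hw' : P (Stone White d jr.1 jr.2 c.+1) <-> (if d is Left then m else n) < c.+1.
  by case: d {hw}; [apply: hm | apply: hn].
case: col; first exact: hw.
split=> [Pb|lt].
  apply/hw; apply: st Pb; last exact: on_top_outer.
    by have [] := rs White d c c0.
  by have [] := rs Black d c c0.
(* A black stone past the cut is exposed, since both white stones on top of it are past the cut. *)
apply: expo; split; first by split=> //; apply: rs.
move=> s _ so; inversion so; subst; first exact/hw.
by apply/hw'; apply: ltnW.
Qed.

End RowCuts.

(** * From pairs of tableaux to simple partitions *)

Section Pyramids.
Variable K : nat.
Local Open Scope classical_set_scope.
Implicit Types p : filling K * filling K.

Definition cell_row (c : nat * nat) : nat * nat := (c.1 + c.2 + 1, c.1 + 1).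

(** An entry minus its index is a cut position; the inequalities are written with sums to avoid
    truncated subtraction. *)
Definition pyramid_of p : set stone := [set s | AD_infty s /\
  let i := (srow s).-1 in let j := slayer s - srow s in
  entry p.1 i j < K /\
  if sside s is Left then entry p.1 i j < spos s + i
  else entry p.2 i j < spos s + j].

Lemma AD_rowsP jr : AD_rows jr <-> exists i j, jr = cell_row (i, j).
Proof.
case: jr => j r; split=> [/= h|[i [k [-> ->]]]]; last by rewrite /AD_rows /=; lia.
by exists r.-1, (j - r); rewrite /cell_row /AD_rows /= in h *; congr pair; lia.
Qed.

Lemma cell_rowE i j : (cell_row (i, j)).2.-1 = i /\ (cell_row (i, j)).1 - (cell_row (i, j)).2 = j.
Proof. by rewrite /=; lia. Qed.

Lemma cell_row_inj : injective cell_row.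
Proof. by case=> i j [i' j'] [e e']; congr pair; lia. Qed.

Section OfTableaux.
Variable p : filling K * filling K.
Hypothesis tp : tableau_pair p.

Lemma semi i j : (entry p.1 i.+1 j < K -> entry p.1 i j < entry p.1 i.+1 j) /\
  entry p.1 i j <= entry p.1 i j.+1.
Proof.
have /and3P[/semistandardP ss _ _] := tp.
by have [/implyP] := ss i j.
Qed.

Lemma cosemi i j : (entry p.2 i j.+1 < K -> entry p.2 i j < entry p.2 i j.+1) /\
  entry p.2 i j <= entry p.2 i.+1 j.
Proof.
have /and3P[_ /cosemistandardP ss _] := tp.
by have [/implyP] := ss i j.
Qed.

Lemma same_support i j : (entry p.1 i j < K) = (entry p.2 i j < K).
Proof.
have /and3P[_ _ /eqP/setP e] := tp.
have [/andP[iK jK]|out] := boolP ((i < K) && (j < K)).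
  by have := e (Ordinal iK, Ordinal jK); rewrite !inE -!entryE.
by apply/idP/idP => /entry_lt; rewrite (negPf out).
Qed.

(** Entries grow strictly down a column; hence the truncated subtraction in [pyramid_cut] is
    exact. *)
Lemma entry1_ge i j : entry p.1 i j < K -> i <= entry p.1 i j.
Proof.
elim: i => // i IH h; have lt := proj1 (semi i j) h.
exact: leq_ltn_trans (IH (ltn_trans lt h)) lt.
Qed.

Lemma entry2_ge i j : entry p.2 i j < K -> j <= entry p.2 i j.
Proof.
elim: j => // j IH h; have lt := proj1 (cosemi i j) h.
exact: leq_ltn_trans (IH (ltn_trans lt h)) lt.
Qed.

Lemma pyramid_cut i j : entry p.1 i j < K ->
  row_cut (pyramid_of p) (cell_row (i, j)) (entry p.1 i j - i) (entry p.2 i j - j).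
Proof.
move=> fK; have gK : entry p.2 i j < K by rewrite -same_support.
have fi := entry1_ge fK; have gj := entry2_ge gK.
move=> [col d l r c] /row_stonesE[A /= el er c0]; rewrite /pyramid_of /= el er /=.
have [-> ->] : (i + 1).-1 = i /\ i + j + 1 - (i + 1) = j by lia.
split; first by move=> [_ [_]]; case: d; lia.
by move=> h; split; [split|split=> //; case: d h; lia].
Qed.

Lemma altered_pyramid i j : altered (pyramid_of p) (cell_row (i, j)) <-> entry p.1 i j < K.
Proof.
split; last first.
  by move=> fK; apply: (cut_altered _ (pyramid_cut fK)); apply/AD_rowsP; exists i, j.
case=> _ [s [[_ [fK _]]] /row_stonesE[_ el er _]].
by move: fK; rewrite el er; have [-> ->] := cell_rowE i j.
Qed.

Lemma alteredP P jr : altered P jr -> exists i j, jr = cell_row (i, j).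
Proof. by move=> [/AD_rowsP]. Qed.

(** Subtracting the index turns strict increase in its direction into weak increase, so the cuts
    increase weakly from each row to the rows beneath it. *)
Lemma pyramid_stable : stable (pyramid_of p).
Proof.
move=> s t sA tA so [_ ht]; split=> //; move: so sA tA ht.
case=> d j r c /= [/= jr c0] [/= jr' c0'].
- by [].
- by case=> fK h; split=> //; case: d h; lia.
- case: r jr jr' => [|i] jr jr' /=; first by move: jr; rewrite /AD_rows /=; lia.
  have -> : j.+1 - i.+2 = j - i.+1 by lia.
  move: (j - i.+1) => k [fK h]; have [s1 _] := semi i k; have [_ s2] := cosemi i k.
  split; first exact: ltn_trans (s1 fK) fK.
  case: d h => h; last exact: leq_ltn_trans s2 h.
  by have := s1 fK; lia.
- have -> : j.+1 - r = (j - r).+1 by move: jr; rewrite /AD_rows /=; lia.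
  move: (r.-1) (j - r) => i k [fK h]; have [_ s1] := semi i k; have [s2 _] := cosemi i k.
  split; first exact: leq_ltn_trans s1 fK.
  case: d h => h; first exact: leq_ltn_trans s1 h.
  by have := s2; rewrite -same_support => /(_ fK); lia.
Qed.

Lemma pyramid_simple : is_simple_partition (pyramid_of p).
Proof.
split; last first.
  move=> jr A alt; have [i [j e]] := alteredP alt; move: A alt; rewrite e => A alt.
  by apply: (cut_simple A (pyramid_cut _)) => //; apply/altered_pyramid.
split=> [s []//| |jr alt]; first exact: pyramid_stable.
have [i [j e]] := alteredP alt; have [A _] := alt; move: A alt; rewrite e => A.
move=> /altered_pyramid/pyramid_cut cut; split; last exact: cut_cofinite cut.
apply: contra_not (cut_infinite A cut) => fin; apply: sub_finite_set fin.
by move=> s [[]].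
Qed.

Definition altered_cells : seq (nat * nat) :=
  [seq (c.1 : nat, c.2 : nat) | c : cell K in level p.1 K].

Lemma altered_cellsP i j : (i, j) \in altered_cells = (entry p.1 i j < K).
Proof.
apply/fintype.imageP/idP => [[c]|h]; first by rewrite inE -entryE => h [-> ->].
have /andP[iK jK] := entry_lt h.
by exists (Ordinal iK, Ordinal jK) => //; rewrite inE -entryE.
Qed.

Lemma altered_pyramid_seq :
  perm_eq (fset_set (altered (pyramid_of p))) [seq cell_row c | c <- altered_cells].
Proof.
apply: fset_set_seq.
  rewrite map_inj_uniq; last exact: cell_row_inj.
  by rewrite map_inj_uniq ?enum_uniq // => -[a b] [a' b'] /= [/val_inj-> /val_inj->].
move=> jr; split=> [alt|/mapP[[i j] h ->]].
  have [i [j e]] := alteredP alt; rewrite e in alt *.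
  by apply/map_f; rewrite altered_cellsP; apply/altered_pyramid.
by apply/altered_pyramid; rewrite -altered_cellsP.
Qed.

Lemma sum_altered_pyramid (F : nat * nat -> nat) :
  \sum_(jr <- fset_set (altered (pyramid_of p))) F jr =
  \sum_(c in level p.1 K) F (cell_row (c.1 : nat, c.2 : nat)).
Proof. by rewrite (perm_big _ altered_pyramid_seq) big_map big_image. Qed.

Lemma finite_altered_pyramid : finite_set (altered (pyramid_of p)).
Proof.
apply/finite_seqP; exists [seq cell_row c | c <- altered_cells].
apply/seteqP; split=> jr.
  move=> alt; have [i [j e]] := alteredP alt; rewrite e in alt *.
  by apply/map_f; rewrite altered_cellsP; apply/altered_pyramid.
by move=> /mapP[[i j] h ->]; apply/altered_pyramid; rewrite -altered_cellsP.
Qed.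

Definition tableau_weight : nat := \sum_(c in level p.1 K) (p.1 c + p.2 c).

Lemma n_altered_pyramid : n_altered (pyramid_of p) = #|level p.1 K|.
Proof.
by rewrite /n_altered (perm_size altered_pyramid_seq) !size_map -cardE.
Qed.

(** A row with entries [f] and [g] at cell [(i, j)] keeps [(f - i) + (g - j)] white stones and has
    height [i + j]; the total is [f + g]. *)
Lemma weight_pyramid : xP (pyramid_of p) + hP (pyramid_of p) = tableau_weight.
Proof.
rewrite /xP /hP !sum_altered_pyramid -big_split; apply: eq_bigr => c.
rewrite inE -entryE => fK /=; rewrite -(entryE p.2).
have A : AD_rows (cell_row (c.1 : nat, c.2 : nat)) by apply/AD_rowsP; exists c.1, c.2.
rewrite (cut_count A (pyramid_cut fK)) /height /=.
have gK := fK; rewrite same_support in gK.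
have arith (a b f g : nat) : a <= f -> b <= g -> f - a + (g - b) + (a + b + 1 - 1) = f + g.
  lia.
exact: arith (entry1_ge fK) (entry2_ge gK).
Qed.

End OfTableaux.

(** The altered rows determine the support, and the cut positions determine the entries on it. *)
Lemma pyramid_of_inj p p' : tableau_pair p -> tableau_pair p' ->
  pyramid_of p = pyramid_of p' -> p = p'.
Proof.
move=> tp tp' e.
have mem i j d c : 0 < c -> (pyramid_of p (Stone White d (cell_row (i, j)).1 (cell_row (i, j)).2 c)
   <-> pyramid_of p' (Stone White d (cell_row (i, j)).1 (cell_row (i, j)).2 c)) by rewrite e.
have sup i j : (entry p.1 i j < K) = (entry p'.1 i j < K).
  by apply/idP/idP => /altered_pyramid h;
    apply/altered_pyramid => //; [rewrite -e | rewrite e]; apply: h.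
have cutI (m m' : nat) : (forall c, 0 < c -> m < c <-> m' < c) -> m = m'.
  move=> h; have [_ h1] := h m'.+1 isT; have [h2 _] := h m.+1 isT.
  by apply/eqP; rewrite eqn_leq -ltnS h1 //= -ltnS h2.
have E i j : entry p.1 i j = entry p'.1 i j /\ entry p.2 i j = entry p'.2 i j.
  have [fK|fK] := boolP (entry p.1 i j < K); last first.
    have out (q : filling K) : ~~ (entry q i j < K) -> entry q i j = K.
      by rewrite -leqNgt => h; apply/eqP; rewrite eqn_leq entry_le h.
    have fK' := fK; rewrite sup in fK'.
    have gK := fK; rewrite (same_support tp) in gK.
    have gK' := fK'; rewrite (same_support tp') in gK'.
    by rewrite (out _ fK) (out _ fK') (out _ gK) (out _ gK').
  have f'K := fK; rewrite sup in f'K.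
  have gK := fK; rewrite (same_support tp) in gK.
  have g'K := f'K; rewrite (same_support tp') in g'K.
  have A : AD_rows (cell_row (i, j)) by apply/AD_rowsP; exists i, j.
  have c1 := pyramid_cut tp fK; have c2 := pyramid_cut tp' f'K.
  have := entry1_ge tp fK; have := entry1_ge tp' f'K.
  have := entry2_ge tp gK; have := entry2_ge tp' g'K.
  have h1 : entry p.1 i j - i = entry p'.1 i j - i.
    apply: cutI => c c0; rewrite -(cutE A c1 White Left c0) -(cutE A c2 White Left c0).
    exact: mem.
  have h2 : entry p.2 i j - j = entry p'.2 i j - j.
    apply: cutI => c c0; rewrite -(cutE A c1 White Right c0) -(cutE A c2 White Right c0).
    exact: mem.
  by split; lia.
case: p p' {tp tp' e mem sup} E => [f g] [f' g'] E; congr pair; apply/ffunP => c.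
  by apply: val_inj; rewrite /= -!entryE; apply: (proj1 (E _ _)).
by apply: val_inj; rewrite /= -!entryE; apply: (proj2 (E _ _)).
Qed.

End Pyramids.

(** * Counting simple partitions of a given weight *)

Section Enumeration.
Local Open Scope classical_set_scope.

(** Bounds the cuts and the indices of altered rows, so that a box of size [K > b] contains all
    tableaux involved. *)
Lemma cut_weight_le P a b (jr : nat * nat) m n :
  simple_partitions_of_weight a b P -> altered P jr -> row_cut P jr m n ->
  m + n + height jr <= b.
Proof.
move=> [_ fin _ <-] /[dup] alt [A _] cut.
rewrite /xP /hP -big_split /= (big_rem jr) /=; last by rewrite in_fset_set //; apply: mem_set.
by rewrite (cut_count A cut) leq_addr.
Qed.

Lemma pyramid_of_surj K a b P : b < K -> simple_partitions_of_weight a b P ->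
  exists2 p : filling K * filling K, tableau_pair p & P = pyramid_of p.
Proof.
move=> bK wP; have [simple _ _ _] := wP.
(* For unaltered rows the implication is vacuous, so [choice] can select cuts for all cells at
   once. *)
have cutP i j : exists mn : nat * nat, altered P (cell_row (i, j)) ->
    row_cut P (cell_row (i, j)) mn.1 mn.2.
  have [alt|nalt] := pselect (altered P (cell_row (i, j))); last by exists (0, 0).
  by have [m [n c]] := simple_partition_cut simple alt; exists (m, n).
have [M hM] := choice (fun c => cutP c.1 c.2).
pose alt i j := `[< altered P (cell_row (i, j)) >].
have cut i j : alt i j -> row_cut P (cell_row (i, j)) (M (i, j)).1 (M (i, j)).2.
  by move=> /asboolP; apply: (hM (i, j)).
(* The bound keeps the entries below [K], so [inord] is faithful and [K] remains free to mark
   unaltered rows. *)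
have small i j : alt i j -> (M (i, j)).1 + (M (i, j)).2 + (i + j) < K.
  move=> h; apply: leq_ltn_trans bK.
  have := cut_weight_le wP (asboolW h) (cut _ _ h); rewrite /height /=; lia.
pose f : filling K := [ffun c : 'I_K * 'I_K =>
  if alt c.1 c.2 then inord ((M (c.1 : nat, c.2 : nat)).1 + c.1) else ord_max].
pose g : filling K := [ffun c : 'I_K * 'I_K =>
  if alt c.1 c.2 then inord ((M (c.1 : nat, c.2 : nat)).2 + c.2) else ord_max].
have fE i j : entry f i j = if alt i j then (M (i, j)).1 + i else K.
  have [/andP[iK jK]|out] := boolP ((i < K) && (j < K)).
    have := entryE f (Ordinal iK, Ordinal jK); rewrite ffunE /= => ->.
    by case: ifP => //= h; have sm := small _ _ h; rewrite inordK //; lia.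
  case: ifP => [h|_]; first by have := small _ _ h; lia.
  apply/eqP; rewrite eqn_leq entry_le leqNgt; apply/negP => /entry_lt h.
  by rewrite h in out.
have gE i j : entry g i j = if alt i j then (M (i, j)).2 + j else K.
  have [/andP[iK jK]|out] := boolP ((i < K) && (j < K)).
    have := entryE g (Ordinal iK, Ordinal jK); rewrite ffunE /= => ->.
    by case: ifP => //= h; have sm := small _ _ h; rewrite inordK //; lia.
  case: ifP => [h|_]; first by have := small _ _ h; lia.
  apply/eqP; rewrite eqn_leq entry_le leqNgt; apply/negP => /entry_lt h.
  by rewrite h in out.
have [[sub st _] _] := simple.
have A i j : AD_rows (cell_row (i, j)) by apply/AD_rowsP; exists i, j.
(* Stability between adjacent layers: an altered lower row forces the upper one to be altered, with
   cuts no larger. *)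
have below i j i' j' :
    (forall d c, on_top (Stone Black d (cell_row (i, j)).1 (cell_row (i, j)).2 c)
                        (Stone White d (cell_row (i', j')).1 (cell_row (i', j')).2 c)) ->
    alt i' j' -> [/\ alt i j, (M (i, j)).1 <= (M (i', j')).1
                   & (M (i, j)).2 <= (M (i', j')).2].
  move=> top h; have c' := cut _ _ h.
  have removed d c : (if d is Left then (M (i', j')).1 else (M (i', j')).2) < c ->
      P (Stone Black d (cell_row (i, j)).1 (cell_row (i, j)).2 c).
    move=> lt; have c0 : 0 < c by apply: leq_ltn_trans lt.
    apply: st (top d c) _; try by split; [apply: A|].
    by apply/(cutE (A i' j') c').
  have al : alt i j.
    apply/asboolP; split=> //.
    exists (Stone Black Left (cell_row (i, j)).1 (cell_row (i, j)).2 (M (i', j')).1.+1); split.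
      exact: removed.
    exact: row_stones_Stone.
  have c := cut _ _ al; split=> //; rewrite -ltnS.
    by apply/(cutE (A i j) c Black Left) => //; apply: removed.
  by apply/(cutE (A i j) c Black Right) => //; apply: removed.
have next i j : alt i.+1 j -> [/\ alt i j, (M (i, j)).1 <= (M (i.+1, j)).1
                   & (M (i, j)).2 <= (M (i.+1, j)).2].
  by apply: below => d c; rewrite /cell_row /= !addn1 addSn; apply: on_top_prev.
have right i j : alt i j.+1 -> [/\ alt i j, (M (i, j)).1 <= (M (i, j.+1)).1
                   & (M (i, j)).2 <= (M (i, j.+1)).2].
  by apply: below => d c; rewrite /cell_row /= !addn1 addnS; apply: on_top_same.
exists (f, g).
  apply/and3P; split.
  - apply/semistandardP => i j; rewrite !fE; split.
      apply/implyP; case: ifP => [/next[-> m _]|]; last by rewrite ltnn.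
      by rewrite addnS ltnS leq_add2r.
    case: (boolP (alt i j.+1)) => [/right[-> m _]|_]; first by rewrite leq_add2r.
    by case: ifP => // h; have := small _ _ h; lia.
  - apply/cosemistandardP => i j; rewrite !gE; split.
      apply/implyP; case: ifP => [/right[-> _ m]|]; last by rewrite ltnn.
      by rewrite addnS ltnS leq_add2r.
    case: (boolP (alt i.+1 j)) => [/next[-> _ m]|_]; first by rewrite leq_add2r.
    by case: ifP => // h; have := small _ _ h; lia.
  - apply/eqP/setP => c; rewrite !inE -!entryE fE gE.
    by case: ifP => // h; have := small _ _ h; lia.
have key s : AD_infty s ->
    [/\ row_stones (cell_row ((srow s).-1, slayer s - srow s)) s & 0 < spos s].
  move=> [As c0]; split=> //; split=> //.
  by move: As; rewrite /AD_rows /cell_row /= => As; congr pair; lia.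
apply/seteqP; split=> s.
  move=> /[dup] Ps /sub /[dup] As /key[rs c0]; split=> //=.
  rewrite fE gE; have al : alt (srow s).-1 (slayer s - srow s).
    by apply/asboolP; split=> //; exists s.
  have sm := small _ _ al; have := proj1 (cut _ _ al s rs) Ps; rewrite al.
  by case: (sside s) => lt; split; lia.
move=> [As]; have [rs c0] := key s As; rewrite /= fE gE.
case: (boolP (alt _ _)) => [al [_ h]|]; last by rewrite ltnn => _ [].
by apply/(cut _ _ al s rs); case: (sside s) h; lia.
Qed.

Definition weighted_pairs K a b : {pred filling K * filling K} :=
  [pred p | [&& tableau_pair p, tableau_weight p + #|level p.1 K| == a & tableau_weight p == b]].

#[global] Arguments weighted_pairs : clear implicits.

(** Presents the set as the image of a finite set, which yields both its finiteness and its
    cardinality. *)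
Lemma simple_partitions_image K a b : b < K ->
  simple_partitions_of_weight a b = [set` [seq pyramid_of p | p in weighted_pairs K a b]].
Proof.
move=> bK; apply/seteqP; split=> P.
  move=> wP; have [p tp e] := pyramid_of_surj bK wP.
  apply/fintype.imageP; exists p => //; rewrite inE tp.
  have [_ _ wa wb] := wP; move: wa wb; rewrite e weight_pyramid // n_altered_pyramid //.
  by move=> -> ->; rewrite !eqxx.
move=> /fintype.imageP[p + ->]; rewrite inE => /and3P[tp /eqP wa /eqP wb].
split; rewrite ?weight_pyramid ?n_altered_pyramid //; first exact: pyramid_simple.
exact: finite_altered_pyramid.
Qed.

Lemma Tcoef_pairs K a b : b < K -> Tcoef a b = #|weighted_pairs K a b|.
Proof.
move=> bK; rewrite /Tcoef (simple_partitions_image a bK) -(size_image (@pyramid_of K)).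
apply: perm_size; apply: fset_set_seq => //.
rewrite map_inj_in_uniq ?enum_uniq // => p p'; rewrite !mem_enum !inE.
by move=> /and3P[tp _ _] /and3P[tp' _ _]; apply: pyramid_of_inj.
Qed.

(** The dual Cauchy identity at [x_i = y_0 q^i] and [y_j = q^j], with [q = y_0 y_1]. The extra [y_0]
    of each cell accounts for the altered rows. *)
Lemma box_prod_coef K a b : ((box_prod K)@_(mon a b))%R = Posz #|weighted_pairs K a b|.
Proof.
pose x i : {mpoly int[2]} := ymon i.+1 i; pose y j : {mpoly int[2]} := ymon j j.
have xy i j : (x i * y j = ymon (i + j).+1 (i + j))%R.
  rewrite /x /y /ymon -mpolyXD; congr ('X_[_])%R; apply/mnmP => k.
  by rewrite mnmDE !mnmE; case: ifP; lia.
have -> : (box_prod K = \prod_(i < K) \prod_(j < K) (1 + x i * y j))%R.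
  rewrite /box_prod -(pair_bigA _ (fun i j : 'I_K => 1 + ymon (i + j).+1 (i + j))%R) /=.
  by apply: eq_bigr => i _; apply: eq_bigr => j _; rewrite xy.
rewrite -dual_cauchy_tableaux raddf_sum /= -sum1_card.
have E (p : filling K * filling K) : (\prod_(c in level p.1 K) (x (p.1 c) * y (p.2 c)))%R =
    ymon (tableau_weight p + #|level p.1 K|) (tableau_weight p).
  under eq_bigr => c _ do rewrite xy.
  rewrite /ymon -sum1_card /tableau_weight -big_split /=.
  rewrite -(big_morph (fun m => ('X_[m])%R : {mpoly int[2]}) (@mpolyXD _ _) (@mpolyX0 _ _)).
  congr ('X_[_])%R; apply/mnmP => k; rewrite mnm_sumE mnmE.
  by case: ifP => h; apply: eq_bigr => c _; rewrite mnmE h // addn1.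
under eq_bigr => p _ do rewrite E mcoeffX.
have monE a' b' : (mon a' b' == mon a b) = (a' == a) && (b' == b).
  apply/eqP/andP => [e|[/eqP-> /eqP->]] //.
  have h i := congr1 (fun m : 'X_{1..2} => m i) e.
  by have := h v0; have := h v1; rewrite !mnmE /= => -> ->.
under eq_bigr => p _ do rewrite monE.
rewrite -natr_sum natz; congr Posz.
rewrite big_mkcond [RHS]big_mkcond /=; apply: eq_bigr => p _.
by rewrite inE; case: tableau_pair => //=; case: andb.
Qed.

End Enumeration.

(* The first three clauses say that the objects in the limit are well defined:
   the cluster variables are polynomials, the stable ones involve no negative
   power, and every coefficient of T counts a finite set. *)
Theorem proposition4p11 :
  [/\ forall k : nat, 0 < k -> tofrac (Fpoly k) = cluster_variable k,
      forall k : nat, 0 < k -> is_power_series (Fstable k),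
      forall a b : nat, finite_set (simple_partitions_of_weight a b)
    & ps_limit Fstable Tseries].
Proof.
split.
- by move=> k _; rewrite FpolyE Fprod_cluster.
- exact: Fstable_power_series.
- move=> a b; rewrite (simple_partitions_image a (ltnSn b)).
  by apply/finite_seqP; exists [seq pyramid_of p | p in weighted_pairs b.+1 a b].
(* At a negative exponent both coefficients are zero for every [k >= 1]. *)
move=> v; case e0 : (v v0 ord0) => [a|a]; last first.
  exists 1 => k k0; rewrite /Tseries e0; apply: Fstable_power_series => //.
  by exists v0; rewrite e0.
case e1 : (v v1 ord0) => [b|b]; last first.
  exists 1 => k k0; rewrite /Tseries e0 e1; apply: Fstable_power_series => //.
  by exists v1; rewrite e1.
have -> : v = expo (mon a b) by apply: col2P; rewrite !mxE mnmE ?e0 ?e1.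
(* For [k > b] the box of size [k] captures both the coefficient of [Gprod k] and all partitions
   with [y_1]-exponent [b]. *)
exists b.+1 => k bk; rewrite Fstable_coef; last exact: leq_trans bk.
rewrite Gprod_box ?mnmE // box_prod_coef /Tseries !mxE !mnmE /=.
by rewrite (Tcoef_pairs _ bk).
Qed.
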